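(* For every integer $t \geq 1$, there is a minor-closed graph class $\mathcal{L}_t^+$ of graphs of treewidth at most $3t-1$ such that for all simple graphs $G$ and $H$ it holds that $G \simeq_t^{\mathrm{L}^+} H$ if and only if $G \equiv_{\mathcal{L}_t^+} H$.
   Context: Graphs are finite, undirected, and without multiple edges; simple means without loops. For graphs $F,G$, $\hom(F,G)$ is the number of homomorphisms from $F$ to $G$, i.e. maps $V(F)\to V(G)$ sending edges to edges. For a class $\mathcal{F}$ of graphs, $G\equiv_{\mathcal{F}} H$ (homomorphism indistinguishability over $\mathcal{F}$) means $\hom(F,G)=\hom(F,H)$ for all $F\in\mathcal{F}$. A class is minor-closed if it is closed under taking graph minors. For a set $X$ and $k \in \mathbb{N}$, $\binom{X}{\leq k}$ is the set of subsets of $X$ of size at most $k$. An element $(g,h) \in V(G)\times V(H)$ is written $gh$. A set $\{g_1h_1,\dots,g_\ell h_\ell\} \subseteq V(G)\times V(H)$ is a partial isomorphism if for all $i,j\in[\ell]$: $g_i=g_j \Leftrightarrow h_i=h_j$, and $g_ig_j\in E(G) \Leftrightarrow h_ih_j \in E(H)$. $G \simeq_t^{\mathrm{L}^+} H$ means that the following system (the level-$t$ Lasserre relaxation for graph isomorphism with non-negativity constraints) in real variables $y_I$, $I \in \binom{V(G)\times V(H)}{\leq 2t}$, is feasible: (i) the matrix $(y_{I\cup J})_{I,J\in\binom{V(G)\times V(H)}{\leq t}}$ is positive semidefinite; (ii) $\sum_{h\in V(H)} y_{I\cup\{gh\}} = y_I$ for all $I \in \binom{V(G)\times V(H)}{\leq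 2t-2}$ and $g\in V(G)$; (iii) $\sum_{g\in V(G)} y_{I\cup\{gh\}} = y_I$ for all $I \in \binom{V(G)\times V(H)}{\leq 2t-2}$ and $h\in V(H)$; (iv) $y_I=0$ for every $I\in\binom{V(G)\times V(H)}{\leq 2t}$ that is not a partial isomorphism; (v) $y_\emptyset=1$; (vi) $y_I\geq 0$ for all $I \in \binom{V(G)\times V(H)}{\leq 2t}$. *)

(* Defs.v *)
From mathcomp Require Import all_boot all_order all_algebra.
From mathcomp Require Import reals.

Set Implicit Arguments.
Unset Strict Implicit.
Unset Printing Implicit Defensive.

Import Order.TTheory GRing.Theory Num.Theory.

(* Loops are allowed: a loop at [x] is [edge x x]. *)
Record graph := Graph {
  vertex :> finType;
  edge : rel vertex;
  edge_sym : symmetric edge }.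

Definition simple (G : graph) : Prop := irreflexive (@edge G).

Definition hom (F G : graph) : nat :=
  #|[set f : {ffun F -> G} |
      [forall x, forall y, edge x y ==> edge (f x) (f y)]]|.

Definition hom_indistinguishable (L : graph -> Prop) (G H : graph) : Prop :=
  forall F : graph, L F -> hom F G = hom F H.

(* The subgraph induced by [S] is connected; the empty set is accepted. *)
Definition connected_in (G : graph) (S : {set G}) : Prop :=
  {in S &, forall x y,
    connect [rel a b | [&& a \in S, b \in S & edge a b]] x y}.

(* [M] is a minor of [F], witnessed by branch sets [B u] for [u : M].
   Contracting an edge removes that edge, so (there being no multiple edges)
   a loop of [M] can only come from a loop of [F]. Since [M] need only match
   its branch sets, a minor is here determined up to isomorphism. *)
Definition is_minor (M F : graph) : Prop :=
  exists B : M -> {set F},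
    [/\ forall u, B u != set0 /\ connected_in (B u),
        forall u v, u != v -> [disjoint B u & B v],
        forall u v, u != v -> edge u v ->
          exists x y, [/\ x \in B u, y \in B v & edge x y]
      & forall u, edge u u -> exists2 x, x \in B u & edge x x].

Definition minor_closed (L : graph -> Prop) : Prop :=
  forall M F : graph, L F -> is_minor M F -> L M.

Definition is_tree (T : graph) : Prop :=
  [/\ simple T,
      0 < #|T|,
      connected_in [set: T]
    & forall c : seq T, ucycle (@edge T) c -> size c <= 2].

Definition tree_decomposition (F T : graph) (bag : T -> {set F}) : Prop :=
  [/\ is_tree T,
      forall x, exists n, x \in bag n,
      forall x y, edge x y -> exists n, (x \in bag n) && (y \in bag n)
    & forall x, connected_in [set n | x \in bag n]].

(* The width of a decomposition is the largest size of a bag minus one. *)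
Definition treewidth_at_most (F : graph) (k : nat) : Prop :=
  exists (T : graph) (bag : T -> {set F}),
    tree_decomposition bag /\ forall n, #|bag n| <= k.+1.

Definition partial_iso (G H : graph) (I : {set G * H}) : bool :=
  [forall p in I, forall q in I,
     ((p.1 == q.1) == (p.2 == q.2)) && (edge p.1 q.1 == edge p.2 q.2)].

Definition subsets_upto (X : finType) (k : nat) : {set {set X}} :=
  [set I : {set X} | #|I| <= k].

Local Open Scope ring_scope.

Definition psd (R : realType) (n : nat) (M : 'M[R]_n) : Prop :=
  M^T = M /\ forall x : 'cV[R]_n, 0 <= (x^T *m M *m x) 0 0.

Definition moment_matrix (R : realType) (X : finType) (t : nat)
    (y : {set X} -> R) : 'M[R]_#|subsets_upto X t| :=
  \matrix_(i, j) y (enum_val i :|: enum_val j).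

(* The values of [y] on sets with more than 2t elements are irrelevant: only
   the variables y_I with #|I| <= 2t occur below. *)
Definition lasserre_plus (R : realType) (t : nat) (G H : graph) : Prop :=
  exists y : {set G * H} -> R,
    [/\ psd (moment_matrix t y),
        forall (I : {set G * H}) (g : G), (#|I| <= 2 * t - 2)%N ->
          \sum_(h : H) y (I :|: [set (g, h)]) = y I,
        forall (I : {set G * H}) (h : H), (#|I| <= 2 * t - 2)%N ->
          \sum_(g : G) y (I :|: [set (g, h)]) = y I,
        forall I : {set G * H}, (#|I| <= 2 * t)%N -> ~~ partial_iso I ->
          y I = 0
      & y set0 = 1 /\
        forall I : {set G * H}, (#|I| <= 2 * t)%N -> 0 <= y I].

(* Main.v *)
(** Call a vertex set decomposed with boundary [B] if it arises from sets of at
    most [2t] vertices by gluing along a common boundary, and by composing a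
    part with boundary [U + W] and a part with boundary [W + V] to one with
    boundary [U + V], where [U], [V], [W] have at most [t] elements. The class
    consists of the graphs whose whole vertex set is decomposed; all bags fit
    into some [U + V + W], and images of decompositions under contractions are
    decompositions.

    Let [y] solve the level-[t] system. By induction on the decomposition, the
    number of extensions of [a : B -> G] to a homomorphism of the part agrees
    with that of [b : B -> H] whenever [y] is nonzero at the set of pairs
    [(a x, b x)]. For compositions, the support condition says that certain
    vectors of the Gram representation of the moment matrix have length [0],
    which gives intertwining relations that are stable under composition, and
    by nonnegativity of [y] an intertwining relation implies the support
    condition.

    Conversely, call tuples [a] of [2t] vertices of [G] and [b] of [H] of the
    same type if no labelled graph of the class distinguishes them. If the
    homomorphism counts agree, each type is realised equally often in [G] and
    in [H]; put [y {(a_i, b_i)} = 1/n] if [a] and [b] have the same type and [n]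
    tuples realise it, and [0] otherwise. With [M] the matrix of these numbers,
    [M^2 = (1 (x) Z) M] for a positive definite [Z], hence [M] is positive
    semidefinite. *)

Require Import Defs.
From mathcomp Require Import all_boot all_order all_algebra.
From mathcomp Require Import reals.
From mathcomp Require Import boolp.
From mathcomp Require Import zify ring lra.

Set Implicit Arguments.
Unset Strict Implicit.
Unset Printing Implicit Defensive.

(** * Decompositions and minors *)

Section Decomposition.
Variables (t : nat) (T : finType) (e : rel T).

(* Besides equal boundaries, the first alternative admits a second part with a
   smaller boundary: identifying labels shrinks the boundary of a part. *)
Definition node (T : finType) (B1 B2 B : {set T}) : Prop :=
  (B1 = B /\ B2 \subset B) \/
  exists U V W : {set T}, [/\ #|U| <= t, #|V| <= t, #|W| <= t &
    [/\ B1 = U :|: W, B2 = W :|: V & B = U :|: V]].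

(** The third alternative lets a join add edges inside its boundary that neither part contains, for
    instance between [U] and [V] in a composition. Both ends lie in the bag [B1 :|: B2], so this
    costs no width. *)
Definition edges_split (S1 S2 B : {set T}) : Prop :=
  forall x y, e x y -> x \in S1 :|: S2 -> y \in S1 :|: S2 ->
    [|| (x \in S1) && (y \in S1), (x \in S2) && (y \in S2)
      | (x \in B) && (y \in B)].

Inductive dec : {set T} -> {set T} -> Prop :=
| dec_base (B : {set T}) : #|B| <= 2 * t -> dec B B
| dec_join (S1 S2 B1 B2 B : {set T}) :
    dec S1 B1 -> dec S2 B2 -> node B1 B2 B ->
    S1 :&: S2 \subset B1 :&: B2 -> edges_split S1 S2 B ->
    dec (S1 :|: S2) B.

Lemma node_sub (B1 B2 B : {set T}) : node B1 B2 B -> B \subset B1 :|: B2.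
Proof.
case=> [[-> _]|[U [V [W [_ _ _ [-> -> ->]]]]]]; first exact: subsetUl.
by apply/subsetP=> x; rewrite !inE => /orP[] ->; rewrite ?orbT.
Qed.

Lemma dec_sub S B : dec S B -> B \subset S.
Proof.
elim=> // S1 S2 B1 B2 {}B _ s1 _ s2 /node_sub sB _ _.
by apply: (subset_trans sB); apply: setUSS.
Qed.

Lemma cardsU_le (A B : {set T}) (m n : nat) :
  #|A| <= m -> #|B| <= n -> #|A :|: B| <= m + n.
Proof.
by move=> hA hB; apply: (leq_trans (leq_card_setU A B)); apply: leq_add.
Qed.

Lemma dec_card S B : dec S B -> #|B| <= 2 * t.
Proof.
elim=> // S1 S2 B1 B2 {}B _ h1 _ _ [[<- _]|] //.
case=> U [V [W [hU hV _ [_ _ ->]]]] _ _.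
by rewrite mul2n -addnn cardsU_le.
Qed.

(** In a composition, [B1 :|: B2] is the union of [U], [V] and [W]; this is the source of the width
    [3t - 1]. *)
Lemma node_card (B1 B2 B : {set T}) : #|B| <= 2 * t -> node B1 B2 B ->
  #|B1 :|: B2| <= 3 * t.
Proof.
move=> hB [[-> /setUidPl->]|[U [V [W [hU hV hW [-> -> _]]]]]].
  by rewrite (leq_trans hB) // leq_mul2r orbT.
rewrite -setUA [W :|: _]setUA setUid setUA.
rewrite (_ : 3 * t = t + t + t); last by lia.
by rewrite !cardsU_le.
Qed.

(** By [node_sub], [x] is on the boundary of one part; if it also lies in the other part, it is in
    [S1 :&: S2] and hence on both boundaries. *)
Lemma join_boundary (S1 S2 B1 B2 B : {set T}) :
  B1 \subset S1 -> B2 \subset S2 -> node B1 B2 B ->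
  S1 :&: S2 \subset B1 :&: B2 ->
  forall x, x \in B -> (x \in S1 -> x \in B1) /\ (x \in S2 -> x \in B2).
Proof.
move=> s1 s2 /node_sub/subsetP sB /subsetP sI x /sB.
rewrite inE => /orP[] xB; split=> xS //.
- have: x \in S1 :&: S2 by rewrite inE (subsetP s1).
  by move/sI; rewrite inE => /andP[].
have: x \in S1 :&: S2 by rewrite inE xS (subsetP s2).
by move/sI; rewrite inE => /andP[].
Qed.

Lemma join_meet (S1 S2 B1 B2 : {set T}) :
  S1 :&: S2 \subset B1 :&: B2 ->
  forall x, x \in S1 -> x \in S2 -> (x \in B1) * (x \in B2).
Proof.
move=> /subsetP sI x x1 x2.
by have := sI x; rewrite !inE x1 x2 /= => /(_ isT)/andP[-> ->].
Qed.

End Decomposition.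

(** Serves both for direct images and for the set of branch sets that meet a given set. *)
Lemma node_image (t : nat) (T T' : finType) (f : {set T} -> {set T'})
    (B1 B2 B : {set T}) :
  (forall A A', f (A :|: A') = f A :|: f A') -> (forall A, #|f A| <= #|A|) ->
  node t B1 B2 B -> node t (f B1) (f B2) (f B).
Proof.
move=> fU fc [[-> /setUidPl B2B]|[U [V [W [hU hV hW [-> -> ->]]]]]].
  by left; split=> //; rewrite -B2B fU subsetUr.
right; exists (f U), (f V), (f W); rewrite !fU.
by split=> //; apply: leq_trans (fc _) _.
Qed.

(* [g] may only identify boundary vertices; this is what happens to labels
   when they are renamed non-injectively. *)
Definition dec_mappable (T T' : finType) (e : rel T) (e' : rel T')
    (g : T -> T') (S B : {set T}) : Prop :=
  {in S &, forall x y, g x = g y -> x = y \/ (x \in B /\ y \in B)} /\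
  {in g @: S &, forall z z', e' z z' ->
     (exists x y, [/\ x \in S, y \in S, g x = z, g y = z' & e x y]) \/
     (z \in g @: B /\ z' \in g @: B)}.

(** Passes [dec_mappable] down to one part of a join: identifications and new edges occur only at
    [B], which meets [S1] inside [B1], and edges of [S] not inside [S1] touch [S1] only in [B1]. *)
Lemma dec_mappable_part (T T' : finType) (e : rel T) (e' : rel T')
    (g : T -> T') (S B S1 B1 : {set T}) :
  S1 \subset S -> B \subset S -> {in B, forall x, x \in S1 -> x \in B1} ->
  {in S &, forall x y, e x y -> (x \in S1 /\ y \in S1) \/
     ((x \in S1 -> x \in B1) /\ (y \in S1 -> y \in B1))} ->
  dec_mappable e e' g S B -> dec_mappable e e' g S1 B1.
Proof.
move=> /subsetP sS /subsetP sB jB jE [ginj ge]; split.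
  move=> x y x1 y1 gxy; have [|[xB yB]] := ginj x y (sS _ x1) (sS _ y1) gxy.
    by left.
  by right; split; apply: jB.
have gB x x' : x \in S1 -> x' \in B -> g x = g x' -> x \in B1.
  move=> x1 x'B /ginj[||xx'|[xB _]]; first exact: sS.
  - exact: sB.
  - by apply: jB => //; rewrite xx'.
  by apply: jB.
have gB1 x x' : x \in S1 -> x' \in S -> (x' \in S1 -> x' \in B1) ->
    g x' = g x -> x \in B1.
  move=> x1 x'S h /esym/ginj[||xx'|[xB _]] //; first exact: sS.
    by rewrite xx' h // -xx'.
  by apply: jB.
move=> z z' /imsetP[x x1 ->] /imsetP[y y1 ->] ezz.
have [] := ge (g x) (g y) (imset_f _ (sS _ x1)) (imset_f _ (sS _ y1)) ezz.
  case=> x' [y' [xS yS gx gy exy]].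
  case: (jE _ _ xS yS exy) => [[]|[hx hy]]; first by left; exists x', y'.
  by right; split; apply: imset_f; [apply: (gB1 _ x')|apply: (gB1 _ y')].
case=> /imsetP[x' x'B zx'] /imsetP[y' y'B zy']; right.
by split; apply: imset_f; [apply: (gB _ x')|apply: (gB _ y')].
Qed.

(** Used below to rename the vertices of labelled parts before gluing them, including non-injective
    renaming of labels. *)
Lemma dec_map (t : nat) (T T' : finType) (e : rel T) (e' : rel T')
    (g : T -> T') (S B : {set T}) :
  dec t e S B -> dec_mappable e e' g S B -> dec t e' (g @: S) (g @: B).
Proof.
elim=> {S B} [B hB _|S1 S2 B1 B2 B d1 IH1 d2 IH2 nB sI es gm].
  by apply: dec_base; apply: leq_trans hB; apply: leq_imset_card.
have jB := join_boundary (dec_sub d1) (dec_sub d2) nB sI.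
have jM := join_meet sI.
have sBS : B \subset S1 :|: S2.
  exact: subset_trans (node_sub nB) (setUSS (dec_sub d1) (dec_sub d2)).
have [ginj ge] := gm.
rewrite imsetU; apply: (@dec_join _ _ _ _ _ (g @: B1) (g @: B2)).
- apply: IH1; apply: dec_mappable_part gm => //; first exact: subsetUl.
    by move=> x /jB[].
  move=> x y xS yS exy.
  have [/andP[]|n1] := boolP ((x \in S1) && (y \in S1)); first by left.
  right; case/or3P: (es _ _ exy xS yS) => /andP[xs ys].
  + by rewrite xs ys in n1.
  + by split=> h; rewrite (jM _ h).
  by have [[? _] [? _]] := (jB _ xs, jB _ ys).
- apply: IH2; apply: dec_mappable_part gm => //; first exact: subsetUr.
    by move=> x /jB[].
  move=> x y xS yS exy.
  have [/andP[]|n1] := boolP ((x \in S2) && (y \in S2)); first by left.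
  right; case/or3P: (es _ _ exy xS yS) => /andP[xs ys].
  + by split=> h; rewrite (jM _ _ h).
  + by rewrite xs ys in n1.
  by have [[_ ?] [_ ?]] := (jB _ xs, jB _ ys).
- apply: (@node_image _ _ _ (fun A => g @: A)) nB => [A A'|A].
    exact: imsetU.
  exact: leq_imset_card.
(* A common point of the two images comes from a common vertex of the parts or from two vertices of
   [B] identified by [g]. *)
- apply/subsetP=> z; rewrite inE => /andP[/imsetP[x x1 zx] /imsetP[y y2 zy]].
  rewrite inE; have := ginj x y; rewrite !inE x1 y2 orbT -zx -zy.
  case/(_ isT isT erefl)=> [xy|[xB yB]].
    have := jM x x1; rewrite xy => /(_ y2)[yB1 yB2].
    by rewrite zx xy !imset_f.
  by rewrite {1}zx zy !imset_f ?(jB _ yB).2 ?(jB _ xB).1.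
move=> z z'; rewrite -imsetU => ezz zS z'S.
have [[x [y [xS yS <- <- exy]]]|[zB z'B]] := ge z z' zS z'S ezz.
  by case/or3P: (es _ _ exy xS yS) => /andP[h1 h2];
    rewrite !(imset_f _ h1) !(imset_f _ h2) ?orbT.
by rewrite zB z'B !orbT.
Qed.

(** * Decompositions pass to minors *)

Definition separates (T : finType) (e : rel T) (S B : {set T}) : Prop :=
  forall x y, e x y -> x \in S -> x \notin B -> y \in S.

Section Minors.
Variables (t : nat) (M F : graph) (br : M -> {set F}).
Hypotheses (br_conn : forall u, br u != set0 /\ connected_in (br u))
  (br_edge : forall u v, u != v -> edge u v ->
     exists x y, [/\ x \in br u, y \in br v & edge x y]).
Hypothesis br_disj : forall u v, u != v -> [disjoint br u & br v].

Let hit (S : {set F}) : {set M} := [set u | ~~ [disjoint br u & S]].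

Lemma hitP (S : {set F}) u : reflect (exists2 x, x \in br u & x \in S) (u \in hit S).
Proof.
rewrite inE; apply: (iffP pred0Pn) => [[x /andP[]]|[x xu xS]]; first by exists x.
by exists x; rewrite /= xu.
Qed.

Lemma hitU (A A' : {set F}) : hit (A :|: A') = hit A :|: hit A'.
Proof.
apply/setP=> u; rewrite in_setU; apply/hitP/orP.
  by case=> x xu; rewrite inE => /orP[] xA; [left|right]; apply/hitP; exists x.
by case=> /hitP[x xu xA]; exists x; rewrite // inE xA ?orbT.
Qed.

(** Choosing a vertex of [A] in each branch set that meets [A] is injective, because branch sets are
    disjoint. *)
Lemma hit_card (A : {set F}) : #|hit A| <= #|A|.
Proof.
have [->|[x0 _]] := set_0Vmem A.
  rewrite cards0 leqn0 cards_eq0; apply/eqP/setP=> u; rewrite in_set0.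
  by apply/negbTE/hitP => -[x _]; rewrite inE.
pose pk u := odflt x0 [pick x in br u :&: A].
have pkP u : u \in hit A -> pk u \in br u /\ pk u \in A.
  case/hitP=> x xu xA; rewrite /pk; case: pickP => [z|/(_ x)].
    by rewrite inE => /andP[].
  by rewrite inE xu xA.
rewrite -(@card_in_imset _ _ pk); last first.
  move=> u v /pkP[pu _] /pkP[pv _] puv; apply/eqP/negPn/negP => /br_disj.
  by move/pred0P/(_ (pk u)); rewrite /= pu puv pv.
by apply/subset_leq_card/subsetP => x /imsetP[u /pkP[_ h] ->].
Qed.

(** A connected branch set can leave [S] only through a vertex of [B]. *)
Lemma hit_inside S B u : separates (@edge F) S B ->
  u \in hit S -> u \notin hit B -> br u \subset S.
Proof.
move=> sep /hitP[x xu xS] nB; apply/subsetP=> y yu.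
have [_ /(_ x y xu yu)/connectP[p]] := br_conn u.
elim: p x xu xS => [|z p IH] x xu xS /= ; first by move=> _ ->.
case/andP=> /and3P[_ zu exz] /IH; apply=> //; apply: sep exz xS _.
by apply: contra nB => xB; apply/hitP; exists x.
Qed.

Lemma separates_join S1 S2 B1 B2 B :
  dec t (@edge F) S1 B1 -> dec t (@edge F) S2 B2 -> node t B1 B2 B ->
  S1 :&: S2 \subset B1 :&: B2 -> edges_split (@edge F) S1 S2 B ->
  separates (@edge F) (S1 :|: S2) B ->
  separates (@edge F) S1 B1 /\ separates (@edge F) S2 B2.
Proof.
move=> d1 d2 nB sI es sep.
have jB := join_boundary (dec_sub d1) (dec_sub d2) nB sI.
have jM := join_meet sI.
split=> x y exy xS xB.
  have nxB : x \notin B by apply: contra xB => /jB[/(_ xS)].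
  have xS12 : x \in S1 :|: S2 by rewrite inE xS.
  case/or3P: (es _ _ exy xS12 (sep _ _ exy xS12 nxB)) => /andP[] // h.
    by rewrite (jM x) in xB.
  by rewrite h in nxB.
have nxB : x \notin B by apply: contra xB => /jB[_ /(_ xS)].
have xS12 : x \in S1 :|: S2 by rewrite inE xS orbT.
case/or3P: (es _ _ exy xS12 (sep _ _ exy xS12 nxB)) => /andP[] // h.
  by rewrite (jM x) in xB.
by rewrite h in nxB.
Qed.

(** Each set of the decomposition is replaced by the branch sets it meets. A branch set meeting both
    parts must meet both boundaries, since by [hit_inside] it would otherwise lie in one part and
    meet [S1 :&: S2]. The separation hypothesis is trivial for the whole vertex set and descends by
    [separates_join]. *)
Lemma dec_minor S B : dec t (@edge F) S B -> separates (@edge F) S B ->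
  dec t (@edge M) (hit S) (hit B).
Proof.
elim=> {S B} [B hB _|S1 S2 B1 B2 B d1 IH1 d2 IH2 nB sI es sep].
  by apply: dec_base; apply: leq_trans hB; apply: hit_card.
have [sep1 sep2] := separates_join d1 d2 nB sI es sep.
have jM := join_meet sI.
rewrite hitU; apply: dec_join (IH1 sep1) (IH2 sep2) _ _ _.
- exact: node_image hitU hit_card nB.
- apply/subsetP=> u; rewrite !in_setI => /andP[u1 u2].
  case/hitP: (u1) => x xu x1; case/hitP: (u2) => y yu y2.
  apply/andP; split; apply/negPn/negP=> nB1.
    have /subsetP/(_ y yu) y1 := hit_inside sep1 u1 nB1.
    by case/negP: nB1; apply/hitP; exists y => //; rewrite (jM y).
  have /subsetP/(_ x xu) x2 := hit_inside sep2 u2 nB1.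
  by case/negP: nB1; apply/hitP; exists x => //; rewrite (jM x).
move=> u v euv; rewrite -hitU => uS vS.
have [uv|nuv] := eqVneq u v.
  by move: uS; rewrite -uv hitU inE => /orP[] ->; rewrite ?orbT.
have [x [y [xu yv exy]]] := br_edge nuv euv.
have [/andP[xS yS]|] := boolP ((x \in S1 :|: S2) && (y \in S1 :|: S2)).
  case/or3P: (es _ _ exy xS yS) => /andP[xs ys]; apply/or3P.
  - by apply: Or31; apply/andP; split; apply/hitP; [exists x|exists y].
  - by apply: Or32; apply/andP; split; apply/hitP; [exists x|exists y].
  by apply: Or33; apply/andP; split; apply/hitP; [exists x|exists y].
(* If the edge [x y] leaves the part, then [u] and [v] are both in [hit B]: otherwise one branch set
   lies inside the part and avoids [B], and separation pulls the other end of the edge inside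
   too. *)
move=> nxy; apply/or3P/Or33.
have yxe : edge y x by rewrite edge_sym.
apply/andP; split; apply/negPn/negP=> nh; case/negP: nxy.
  have xS := subsetP (hit_inside sep uS nh) _ xu.
  rewrite xS (sep x) //; apply: contra nh => xB.
  by apply/hitP; exists x.
have yS := subsetP (hit_inside sep vS nh) _ yv.
rewrite yS andbT (sep y) //; apply: contra nh => yB.
by apply/hitP; exists y.
Qed.

Lemma hitT : hit [set: F] = [set: M].
Proof.
apply/setP=> u; rewrite in_setT; apply/hitP.
by have [/set0Pn[x xu] _] := br_conn u; exists x; rewrite ?inE.
Qed.

End Minors.

Definition lasserre_class (t : nat) (F : graph) : Prop :=
  exists B : {set F}, dec t (@edge F) [set: F] B.

Lemma lasserre_class_minor_closed t : minor_closed (lasserre_class t).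
Proof.
move=> M F [B dB] [br [conn disj ed _]].
exists [set u | ~~ [disjoint br u & B]].
by rewrite -(hitT conn); apply: dec_minor dB _ => // x y; rewrite !inE.
Qed.

(** * Treewidth *)

Section ParentTree.
Variables (n : nat) (p : 'I_n.+1 -> 'I_n.+1).
Hypothesis p_lt : forall i, i != ord0 -> p i < i.

Definition parent_rel : rel 'I_n.+1 := fun i j =>
  (i != ord0) && (p i == j) || (j != ord0) && (p j == i).

Lemma parent_rel_sym : symmetric parent_rel.
Proof. by move=> i j; rewrite /parent_rel orbC. Qed.

Definition parent_tree : graph := Graph parent_rel_sym.

(** Going to the parent lowers the index, so from every vertex of [A] the path of parents stays in
    [A] and ends at [m]. *)
Lemma parent_connected (A : {set parent_tree}) (m : parent_tree) :
  (forall i : parent_tree, i \in A -> i != m -> i != ord0 /\ p i \in A) ->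
  connected_in A.
Proof.
move=> hA; pose r := [rel a b : parent_tree | [&& a \in A, b \in A & edge a b]].
have rs : connect_sym r.
  by apply: sym_connect_sym => i j; rewrite /= parent_rel_sym andbCA.
have to_m (k : nat) (i : parent_tree) : i < k -> i \in A -> connect r m i.
  elim: k i => // k IH i ik iA.
  have [->|im] := eqVneq i m; first exact: connect0.
  have [i0 piA] := hA i iA im.
  apply: (@connect_trans _ _ (p i)).
    by apply: IH piA; apply: leq_trans (p_lt i0) _.
  by apply: connect1; rewrite /= piA iA /parent_rel i0 eqxx orbT.
move=> i j iA jA; apply: (@connect_trans _ _ m).
  by rewrite rs; apply: (to_m n.+1).
by apply: (to_m n.+1).
Qed.

(** On a cycle of length at least 3, both neighbours of the largest vertex are smaller, so both are
    its parent and the cycle repeats a vertex. *)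
Lemma parent_tree_is_tree : is_tree parent_tree.
Proof.
split.
- move=> i; rewrite /= /parent_rel orbb; apply/negP=> /andP[i0 /eqP pi].
  by have := p_lt i0; rewrite pi ltnn.
- by rewrite card_ord.
- apply: (@parent_connected _ ord0) => i _ i0; by rewrite inE.
move=> c uc; rewrite leqNgt; apply/negP=> c3.
have [x xc] : exists x, x \in c.
  by case: c c3 {uc} => // x c _; exists x; rewrite inE eqxx.
have [m mc mmax] := @arg_maxnP _ x [in c] (fun i => val i) xc.
have {}mc : m \in c by [].
have [k s ec] := rot_to mc.
have : ucycle (@edge parent_tree) (m :: s) by rewrite -ec rot_ucycle.
have sc : {subset s <= c}.
  by move=> z zs; rewrite -(mem_rot k) ec inE zs orbT.
have s2 : 1 < size s by move: c3; rewrite -(size_rot k) ec.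
have nb (z : parent_tree) : z \in s -> m \notin s -> edge m z -> z = p m.
  move=> zs ms /orP[/andP[_ /eqP] //|/andP[z0 /eqP pz]].
  have := p_lt z0; rewrite pz => mz.
  by have := mmax z (sc _ zs); rewrite /= leqNgt mz.
case: s s2 {ec sc} nb => // y [|z s] // _ nb.
rewrite /ucycle (cycle_path m) /= -!andbA.
case/and5P=> lm my _ _ /and3P[ms ys us].
have ey : y = p m by apply: nb; rewrite ?inE ?eqxx.
have el : last z s = p m.
  apply: nb => //; first by rewrite inE (mem_last z s) orbT.
  by rewrite (@edge_sym parent_tree).
by move: ys; rewrite ey -el mem_last.
Qed.

End ParentTree.

Section RunningIntersection.
Variables (t : nat) (T : finType) (e : rel T).

Implicit Types (s : seq {set T}) (b : {set T}).

Definition bag_of s i : {set T} := nth set0 s i.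

(** The bag with index [k] will be the parent of bag [i] in the decomposition tree. *)
Definition running_intersection s : Prop :=
  forall i, 0 < i < size s ->
    exists2 k, k < i & forall j, j < i -> bag_of s i :&: bag_of s j \subset bag_of s k.

Lemma running_intersection_rcons s b k :
  running_intersection s -> k < size s ->
  (forall j, j < size s -> b :&: bag_of s j \subset bag_of s k) ->
  running_intersection (rcons s b).
Proof.
move=> ris ks hb i; rewrite size_rcons ltnS (leq_eqVlt i) => /andP[i0].
have bagE j : j < size s -> bag_of (rcons s b) j = bag_of s j.
  by rewrite /bag_of nth_rcons => ->.
case/orP=> [/eqP ei|si].
  exists k; first by rewrite ei.
  move=> j; rewrite ei => js; rewrite (bagE j) // (bagE k) //.
  by rewrite {1}/bag_of nth_rcons ltnn eqxx hb.
have [|l li hl] := ris i; first by rewrite i0.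
exists l => // j ji; rewrite !bagE //; first exact: hl.
  exact: ltn_trans li si.
exact: ltn_trans ji si.
Qed.

Definition bags_cover s (S : {set T}) : Prop :=
  {in S, forall x, has (fun b => x \in b) s} /\
  {in S &, forall x y, e x y -> has (fun b => (x \in b) && (y \in b)) s}.

(** The list [s] holds the bags built so far; [B] lies in one of them and [S] meets them only in
    [B]. A join appends the bag [B1 :|: B2], then the bags of [S1], then those of [S2]; the new bag
    contains both [B1] and [B2], so it serves as the attachment point for both parts. A base part
    needs no new bag. *)
Lemma dec_bags S B s k :
  dec t e S B -> running_intersection s -> k < size s -> B \subset bag_of s k ->
  (forall j, j < size s -> S :&: bag_of s j \subset B) ->
  exists s', [/\ running_intersection (s ++ s'),
    {in s', forall b, b \subset S /\ #|b| <= 3 * t} & bags_cover (s ++ s') S].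
Proof.
move=> d; elim: d s k => {S B} [B hB|S1 S2 B1 B2 B d1 IH1 d2 IH2 nB sI es] s k.
  move=> ris ks /subsetP sB _; exists [::]; rewrite cats0; split=> //.
  have inb : bag_of s k \in s by apply: mem_nth.
  split=> [x xB|x y xB yB _]; apply/hasP; exists (bag_of s k) => //.
    exact: sB.
  by rewrite !sB.
move=> ris ks sB hs.
have jB := join_boundary (dec_sub d1) (dec_sub d2) nB sI.
have jM := join_meet sI.
have sBS := node_sub nB.
set b := B1 :|: B2.
have bS : b \subset S1 :|: S2 := setUSS (dec_sub d1) (dec_sub d2).
have bc : #|b| <= 3 * t.
  exact: node_card (dec_card (dec_join d1 d2 nB sI es)) nB.
pose s0 := rcons s b.
have ri0 : running_intersection s0.
  apply: running_intersection_rcons ks _ => // j js.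
  by apply: subset_trans sB; apply: subset_trans (hs j js); apply: setSI.
have bag0 : bag_of s0 (size s) = b by rewrite /bag_of nth_rcons ltnn eqxx.
have ks0 : size s < size s0 by rewrite size_rcons.
have hs0 (A C : {set T}) : A \subset S1 :|: S2 -> A :&: b \subset C ->
    {in B, forall x, x \in A -> x \in C} ->
    forall j, j < size s0 -> A :&: bag_of s0 j \subset C.
  move=> AS Ab AC j; rewrite size_rcons ltnS leq_eqVlt => /orP[/eqP->|js].
    by rewrite bag0.
  rewrite /bag_of nth_rcons js; apply/subsetP=> x; rewrite inE => /andP[xA xj].
  apply: AC => //; apply: (subsetP (hs j js)).
  by rewrite inE xj (subsetP AS).
have S1b : S1 :&: b \subset B1.
  apply/subsetP=> x; rewrite !inE => /andP[x1 /orP[//|x2]].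
  by rewrite (jM x) // (subsetP (dec_sub d2)).
have S2b : S2 :&: b \subset B2.
  apply/subsetP=> x; rewrite !inE => /andP[x1 /orP[x2|//]].
  by rewrite (jM x) // (subsetP (dec_sub d1)).
have [||s1 [ri1 sub1 [cv1 ce1]]] := IH1 s0 (size s) ri0 ks0.
- by rewrite bag0 subsetUl.
- by apply: hs0 => // [|x /jB[]//]; apply: subsetUl.
have [|||s2 [ri2 sub2 [cv2 ce2]]] := IH2 (s0 ++ s1) (size s) ri1.
- by rewrite size_cat ltn_addr.
- by rewrite /bag_of nth_cat ks0 -/(bag_of _ _) bag0 subsetUr.
- move=> j js; rewrite /bag_of nth_cat; case: ifP => [js0|js0].
    by apply: hs0 => // [|x /jB[]//]; apply: subsetUr.
  have /sub1[/subsetP h _] : nth set0 s1 (j - size s0) \in s1.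
    rewrite mem_nth // ltn_subLR; first by rewrite -size_cat.
    by rewrite leqNgt js0.
  apply/subsetP=> x; rewrite inE => /andP[x2 /h x1].
  by rewrite (jM x).
exists (b :: s1 ++ s2).
have cE : s ++ b :: s1 ++ s2 = (s0 ++ s1) ++ s2.
  by rewrite -cat_rcons catA.
rewrite cE; split=> //.
  move=> b'; rewrite inE mem_cat => /or3P[/eqP->//|/sub1[h c]|/sub2[h c]].
    by split=> //; apply: subset_trans h (subsetUl _ _).
  by split=> //; apply: subset_trans h (subsetUr _ _).
split=> [x|x y xS yS exy].
  by rewrite inE => /orP[/cv1 h|/cv2 //]; rewrite has_cat h.
case/or3P: (es _ _ exy xS yS) => /andP[xs ys].
- by rewrite has_cat ce1.
- exact: ce2.
rewrite /s0 !has_cat has_rcons.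
by have := subsetP sBS _ xs; have := subsetP sBS _ ys; rewrite -/b => -> ->.
Qed.

End RunningIntersection.

Lemma lasserre_class_treewidth t F : 0 < t ->
  lasserre_class t F -> treewidth_at_most F (3 * t - 1).
Proof.
move=> t0 [B dB].
have Bc : #|B| <= 3 * t.
  by apply: leq_trans (dec_card dB) _; rewrite leq_mul2r orbT.
have [||||s' [ri sub [cv ce]]] := @dec_bags _ _ _ _ _ [:: B] 0 dB => //.
- by move=> i; case: i => [|[]].
- by move=> [|j] // _; rewrite /bag_of /= subsetIr.
pose s := B :: s'; pose n := size s'.
have [p hp] : exists p : 'I_n.+1 -> 'I_n.+1, forall i : 'I_n.+1, i != ord0 ->
    p i < i /\ forall j : nat, j < i ->
      bag_of s i :&: bag_of s j \subset bag_of s (p i).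
  apply: (@fin_all_exists _ (fun=> 'I_n.+1) (fun i k => i != ord0 -> k < i /\
    forall j : nat, j < i -> bag_of s i :&: bag_of s j \subset bag_of s k)).
  move=> i; have [->|i0] := eqVneq i ord0; first by exists ord0.
  have [|k ki hk] := ri i; first by rewrite lt0n i0 /=.
  by exists (Ordinal (ltn_trans ki (ltn_ord i))).
have plt i i0 := (hp i i0).1.
have bagP (P : pred {set F}) : has P s ->
    exists i : parent_tree p, P (bag_of s (val i)).
  case/(hasP)=> b /(nthP set0)[i ils <-] Pb.
  by exists (Ordinal ils : 'I_n.+1).
exists (parent_tree p), (fun i => bag_of s (val i)); split; last first.
  move=> i; rewrite subn1 prednK ?muln_gt0 //.
  have : bag_of s (val i) \in s by apply: mem_nth; apply: ltn_ord.
  by rewrite inE => /orP[/eqP->//|/sub[]].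
split.
- exact: parent_tree_is_tree.
- by move=> x; apply: (bagP (fun b => x \in b)); apply: cv; rewrite inE.
- by move=> x y exy; apply: (bagP (fun b => (x \in b) && (y \in b)));
    apply: ce; rewrite ?inE.
move=> x.
have [i0 xi0] : exists i : parent_tree p, x \in bag_of s (val i).
  by apply: (bagP (fun b => x \in b)); apply: cv; rewrite inE.
(* Let [m] be the first bag containing [x]. For a later bag [i] with [x], the intersection of bags
   [i] and [m] lies in the parent of [i], so the parent contains [x] as well. *)
have [m xm mmin] := @arg_minnP _ i0 (fun i : 'I_n.+1 => x \in bag_of s (val i))
  (fun i => val i) xi0.
apply: (@parent_connected _ _ plt _ m) => i; rewrite !inE => xi im.
have mi : m < i.
  by rewrite ltn_neqAle (mmin i xi) andbT; apply: contra im => /eqP/val_inj->.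
have i00 : i != ord0 by apply: contraTneq mi => ->.
split=> //; apply: (subsetP ((hp i i00).2 m mi)).
by rewrite inE xi.
Qed.

(** * Labelled graphs as formulas *)

Section Join.
Variables (A B K : finType).

Definition join (p : {ffun A -> K}) (q : {ffun B -> K}) : {ffun A + B -> K} :=
  [ffun x => match x with inl i => p i | inr j => q j end].

Definition lpart (f : {ffun A + B -> K}) : {ffun A -> K} := [ffun i => f (inl i)].
Definition rpart (f : {ffun A + B -> K}) : {ffun B -> K} := [ffun j => f (inr j)].

Lemma joinK f : join (lpart f) (rpart f) = f.
Proof. by apply/ffunP => -[i|j]; rewrite !ffunE. Qed.

Lemma lpart_join p q : lpart (join p q) = p.
Proof. by apply/ffunP => i; rewrite !ffunE. Qed.

Lemma rpart_join p q : rpart (join p q) = q.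
Proof. by apply/ffunP => i; rewrite !ffunE. Qed.

Lemma sum_join (M : nmodType) (F : {ffun A + B -> K} -> M) :
  (\sum_f F f = \sum_p \sum_q F (join p q))%R.
Proof.
rewrite pair_big /=.
rewrite (reindex_onto (fun pq => join pq.1 pq.2) (fun f => (lpart f, rpart f))) /=.
  by apply: eq_bigl => -[p q] /=; rewrite lpart_join rpart_join eqxx.
by move=> f _; rewrite joinK.
Qed.

End Join.

Section Formulas.
Variable t : nat.

Definition labels : finType := ('I_t + 'I_t)%type.

(** Syntax for graphs with [t] left and [t] right labels; [eval phi a] counts the homomorphisms that
    send the labels to [a]. [FAnd] glues along all labels, [FComp] glues right to left labels and
    forgets them, [FSub] renames labels, possibly identifying some. *)
Inductive formula :=
| FEdge of labels & labels
| FEq of labels & labels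
| FAnd of formula & formula
| FComp of formula & formula
| FSub of {ffun labels -> labels} & formula.

Fixpoint eval (G : graph) (phi : formula) (a : {ffun labels -> G}) : nat :=
  match phi with
  | FEdge i j => edge (a i) (a j)
  | FEq i j => a i == a j
  | FAnd phi psi => eval phi a * eval psi a
  | FComp phi psi => \sum_(w : {ffun 'I_t -> G})
      eval phi (join (lpart a) w) * eval psi (join w (rpart a))
  | FSub s phi => eval phi [ffun i => a (s i)]
  end.

(* A constraint [(true, x, y)] asks for an edge, [(false, x, y)] for an
   equality. *)
Definition constraint (X : Type) : Type := (bool * X * X)%type.

Definition satisfies (X : Type) (G : graph) (f : X -> G) (c : constraint X) : bool :=
  if c.1.1 then edge (f c.1.2) (f c.2) else f c.1.2 == f c.2.

Definition links (X : eqType) (c : constraint X) (x y : X) : bool :=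
  (c.1.2 == x) && (c.2 == y) || (c.1.2 == y) && (c.2 == x).

(** Equality constraints also give edges here; contracting these edges yields the minor of
    [quotient_minor]. *)
Definition primal (X : eqType) (C : seq (constraint X)) : rel X :=
  fun x y => has (fun c => links c x y) C.

Definition push (X Y : Type) (g : X -> Y) (c : constraint X) : constraint Y :=
  (c.1.1, g c.1.2, g c.2).

Lemma satisfies_push (X Y : Type) (G : graph) (g : X -> Y) (f : Y -> G) c :
  satisfies f (push g c) = satisfies (f \o g) c.
Proof. by []. Qed.

Lemma primal_push (X Y : eqType) (g : X -> Y) (C : seq (constraint X)) z z' :
  primal (map (push g) C) z z' ->
  exists x y, [/\ g x = z, g y = z' & primal C x y].
Proof.
case/hasP=> _ /mapP[c cC ->] /orP[] /andP[/eqP /= <- /eqP /= <-].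
  by exists c.1.2, c.2; split=> //; apply/hasP; exists c; rewrite // /links !eqxx.
exists c.2, c.1.2; split=> //; apply/hasP; exists c; rewrite // /links !eqxx.
by rewrite orbT.
Qed.

Definition label_set (V : finType) : {set labels + V} := inl @: [set: labels].

(** The elements of [V] are the unlabelled vertices, and the labels form the boundary of the
    decomposition. *)
Definition represented (phi : formula) : Prop :=
  exists (V : finType) (C : seq (constraint (labels + V))),
    dec t (primal C) [set: labels + V] (label_set V) /\
    forall (G : graph) (a : {ffun labels -> G}),
      eval phi a = \sum_(f : {ffun V -> G}) all (satisfies (join a f)) C.

Lemma card_label_set (V : finType) : #|label_set V| = 2 * t.
Proof.
rewrite card_imset; last by move=> x y [].
by rewrite cardsT card_sum card_ord addnn mul2n.
Qed.

Lemma represented_constraint (phi : formula) (b : bool) i j :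
  (forall (G : graph) (a : {ffun labels -> G}), eval phi a = satisfies a (b, i, j)) ->
  represented phi.
Proof.
move=> h; exists void, [:: (b, inl i, inl j)]; split.
  have -> : [set: labels + void] = label_set void.
    by apply/setP=> -[x|[]]; rewrite inE; apply/esym/imsetP; exists x.
  by apply: dec_base; rewrite card_label_set.
move=> G a; rewrite h (big_pred1 (ffun0 (card_void))) => [|f].
  by rewrite /= andbT /satisfies /= !ffunE.
by apply/esym/eqP/ffunP => -[].
Qed.

Lemma primal_cat (X : eqType) (C1 C2 : seq (constraint X)) x y :
  primal (C1 ++ C2) x y = primal C1 x y || primal C2 x y.
Proof. by rewrite /primal has_cat. Qed.

Lemma all_satisfies_push (X Y : finType) (G : graph) (g : X -> Y)
    (f : {ffun Y -> G}) (h : {ffun X -> G}) C : (forall x, f (g x) = h x) ->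
  all (satisfies f) (map (push g) C) = all (satisfies h) C.
Proof.
move=> fg; rewrite all_map; apply: eq_all => c.
by rewrite /= satisfies_push /satisfies /= !fg.
Qed.

Lemma represented_And phi psi :
  represented phi -> represented psi -> represented (FAnd phi psi).
Proof.
case=> V1 [C1 [d1 h1]] [V2 [C2 [d2 h2]]].
pose g1 (x : labels + V1) : labels + (V1 + V2) :=
  match x with inl i => inl i | inr v => inr (inl v) end.
pose g2 (x : labels + V2) : labels + (V1 + V2) :=
  match x with inl i => inl i | inr v => inr (inr v) end.
exists (V1 + V2)%type, (map (push g1) C1 ++ map (push g2) C2); split; last first.
  move=> G a; rewrite /= h1 h2 big_distrlr /= [RHS]sum_join.
  apply: eq_bigr => f1 _; apply: eq_bigr => f2 _.
  rewrite mulnb all_cat.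
  rewrite (@all_satisfies_push _ _ _ g1 _ (join a f1)); last first.
    by case=> x; rewrite !ffunE /= ?ffunE.
  rewrite (@all_satisfies_push _ _ _ g2 _ (join a f2)) //.
  by case=> x; rewrite !ffunE /= ?ffunE.
have l1 : g1 @: label_set V1 = label_set _.
  by rewrite /label_set -imset_comp; apply: eq_imset => x.
have l2 : g2 @: label_set V2 = label_set _.
  by rewrite /label_set -imset_comp; apply: eq_imset => x.
have -> : [set: labels + (V1 + V2)] = g1 @: [set: _] :|: g2 @: [set: _].
  apply/setP => -[x|[v|v]]; rewrite !inE; apply/esym/orP.
  - by left; apply/imsetP; exists (inl x).
  - by left; apply/imsetP; exists (inr v).
  by right; apply/imsetP; exists (inr v).
set C := _ ++ _.
have inl_label (x : labels) (V : finType) : inl x \in label_set V by apply: imset_f.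
apply: (@dec_join _ _ _ _ _ (label_set _) (label_set _)); last 3 first.
- by left.
- rewrite setIid; apply/subsetP => z.
  rewrite inE => /andP[/imsetP[x _ ->] /imsetP[x' _]].
  by case: x x' => [x|v] [x'|v'] //= _; apply: imset_f.
- move=> z z'; rewrite primal_cat => /orP[] /primal_push[x [y [<- <- _]]] _ _;
  by rewrite !imset_f ?orbT.
- rewrite -l1; apply: dec_map d1 _; split.
    by move=> [x|v] [x'|v'] _ _ //= [->]; left.
  move=> _ _ /imsetP[x0 _ ->] /imsetP[y0 _ ->].
  rewrite primal_cat => /orP[] /primal_push[x [y [ex ey exy]]].
    by left; exists x, y.
  (* A constraint of [C2] between points of the first image involves labels only, as the two images
     share nothing else. *)
  right; rewrite l1 -ex -ey; move: ex ey.
  by case: x0 y0 x y {exy} => [x0|v0] [y0|u0] [x|v] [y|u] //= _ _.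
rewrite -l2; apply: dec_map d2 _; split.
  by move=> [x|v] [x'|v'] _ _ //= [->]; left.
move=> _ _ /imsetP[x0 _ ->] /imsetP[y0 _ ->].
rewrite primal_cat => /orP[] /primal_push[x [y [ex ey exy]]]; last first.
  by left; exists x, y.
right; rewrite l2 -ex -ey; move: ex ey.
by case: x0 y0 x y {exy} => [x0|v0] [y0|u0] [x|v] [y|u] //= _ _.
Qed.

(** The renamed part has boundary [g @: label_set V], which may miss labels. Joining it to a base
    part on all labels, by the first kind of [node], restores the full boundary. *)
Lemma represented_Sub s phi : represented phi -> represented (FSub s phi).
Proof.
case=> V [C [d h]].
pose g (x : labels + V) : labels + V :=
  match x with inl i => inl (s i) | inr v => inr v end.
have sub_setT : [set: labels + V] = label_set V :|: g @: [set: _].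
  apply/setP => -[x|v]; rewrite !inE; apply/esym/orP.
    by left; apply: imset_f.
  by right; apply/imsetP; exists (inr v).
exists V, (map (push g) C); split; last first.
  move=> G a; rewrite /= h; apply: eq_bigr => f _.
  rewrite (@all_satisfies_push _ _ _ g _ (join [ffun i => a (s i)] f)) //.
  by case=> x; rewrite !ffunE /= ?ffunE.
have gl : g @: label_set V \subset label_set V.
  by apply/subsetP => _ /imsetP[_ /imsetP[x _ ->] ->]; apply: imset_f.
rewrite sub_setT; apply: (@dec_join _ _ _ _ _ (label_set V) (g @: label_set V)).
- by apply: dec_base; rewrite card_label_set.
- apply: dec_map d _; split.
    move=> [x|v] [x'|v'] _ _ //= [e]; last by left; rewrite e.
    by right; split; apply: imset_f.
  move=> z z' _ _ /primal_push[x [y [<- <- exy]]].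
  by left; exists x, y.
- by left.
- apply/subsetP => z; rewrite inE => /andP[zl /imsetP[x _ ex]]; rewrite inE zl /=.
  move: zl; rewrite ex; case/imsetP => i _; case: x {ex} => //= j _.
  by rewrite -[inl (s j)]/(g (inl j)) !imset_f.
move=> z z' /primal_push[x [y [<- <- _]]] _ _.
by rewrite !(imset_f g) ?orbT.
Qed.

(** The tuple [w] summed over in [FComp] becomes [t] further unlabelled vertices, the set [W] of a
    composition node between the left labels [U] and the right labels [V]. *)
Lemma represented_Comp phi psi :
  represented phi -> represented psi -> represented (FComp phi psi).
Proof.
case=> V1 [C1 [d1 h1]] [V2 [C2 [d2 h2]]].
pose X : finType := (labels + ('I_t + (V1 + V2)))%type.
pose g1 (x : labels + V1) : X := match x with
  | inl (inl i) => inl (inl i) | inl (inr i) => inr (inl i)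
  | inr v => inr (inr (inl v)) end.
pose g2 (x : labels + V2) : X := match x with
  | inl (inl i) => inr (inl i) | inl (inr i) => inl (inr i)
  | inr v => inr (inr (inr v)) end.
exists ('I_t + (V1 + V2))%type, (map (push g1) C1 ++ map (push g2) C2).
split; last first.
  move=> G a; rewrite /= [RHS]sum_join; apply: eq_bigr => w _.
  rewrite h1 h2 big_distrlr /= sum_join.
  apply: eq_bigr => f1 _; apply: eq_bigr => f2 _.
  rewrite mulnb all_cat.
  rewrite (@all_satisfies_push _ _ _ g1 _ (join (join (lpart a) w) f1)); last first.
    by case=> [[]|] x; rewrite !ffunE /= ?ffunE /= ?ffunE.
  rewrite (@all_satisfies_push _ _ _ g2 _ (join (join w (rpart a)) f2)) //.
  by case=> [[]|] x; rewrite !ffunE /= ?ffunE /= ?ffunE.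
have inj1 : injective g1 by move=> [[x|x]|x] [[z|z]|z] //= [->].
have inj2 : injective g2 by move=> [[x|x]|x] [[z|z]|z] //= [->].
pose U : {set X} := [set inl (inl i) | i : 'I_t].
pose W : {set X} := [set inr (inl i) | i : 'I_t].
pose V : {set X} := [set inl (inr i) | i : 'I_t].
have l1 : g1 @: label_set V1 = U :|: W.
  apply/setP => z; rewrite inE; apply/imsetP/orP.
    by case=> _ /imsetP[[i|i] _ ->] ->; [left|right]; apply: imset_f.
  by case=> /imsetP[i _ ->]; [exists (inl (inl i))|exists (inl (inr i))];
    rewrite ?imset_f.
have l2 : g2 @: label_set V2 = W :|: V.
  apply/setP => z; rewrite inE; apply/imsetP/orP.
    by case=> _ /imsetP[[i|i] _ ->] ->; [left|right]; apply: imset_f.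
  by case=> /imsetP[i _ ->]; [exists (inl (inl i))|exists (inl (inr i))];
    rewrite ?imset_f.
have l : label_set ('I_t + (V1 + V2))%type = U :|: V.
  apply/setP => z; rewrite inE; apply/imsetP/orP.
    by case=> -[i|i] _ ->; [left|right]; apply: imset_f.
  by case=> /imsetP[i _ ->]; [exists (inl i)|exists (inr i)].
have -> : [set: X] = g1 @: [set: _] :|: g2 @: [set: _].
  apply/setP => -[[x|x]|[x|[v|v]]]; rewrite !inE; apply/esym/orP.
  - by left; apply/imsetP; exists (inl (inl x)).
  - by right; apply/imsetP; exists (inl (inr x)).
  - by left; apply/imsetP; exists (inl (inr x)).
  - by left; apply/imsetP; exists (inr v).
  by right; apply/imsetP; exists (inr v).
have meet x1 x2 : g1 x1 = g2 x2 -> g1 x1 \in W.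
  by case: x1 x2 => [[i|i]|v] [[j|j]|u] //= _; apply: imset_f.
rewrite l; apply: (@dec_join _ _ _ _ _ (U :|: W) (W :|: V)).
- rewrite -l1; apply: dec_map d1 _; split; first by move=> x y _ _ /inj1 ->; left.
  move=> _ _ /imsetP[x0 _ ->] /imsetP[y0 _ ->].
  rewrite primal_cat => /orP[] /primal_push[x [y [ex ey exy]]].
    by left; exists x, y.
  by right; rewrite l1 !inE (meet _ _ (esym ex)) (meet _ _ (esym ey)) !orbT.
- rewrite -l2; apply: dec_map d2 _; split; first by move=> x y _ _ /inj2 ->; left.
  move=> _ _ /imsetP[x0 _ ->] /imsetP[y0 _ ->].
  rewrite primal_cat => /orP[] /primal_push[x [y [ex ey exy]]]; last first.
    by left; exists x, y.
  by right; rewrite l2 -ex -ey !inE (meet _ _ ex) (meet _ _ ey).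
- right; exists U, V, W; split=> //.
  + by apply: leq_trans (leq_imset_card _ _) _; rewrite card_ord.
  + by apply: leq_trans (leq_imset_card _ _) _; rewrite card_ord.
  by apply: leq_trans (leq_imset_card _ _) _; rewrite card_ord.
- apply/subsetP => z; rewrite inE => /andP[/imsetP[x1 _ ->] /imsetP[x2 _ /meet zW]].
  by rewrite !inE zW orbT.
move=> z z'; rewrite primal_cat => /orP[] /primal_push[x [y [<- <- _]]] _ _;
by rewrite !imset_f ?orbT.
Qed.

Lemma formula_represented phi : represented phi.
Proof.
elim: phi => [i j|i j|phi h1 psi h2|phi h1 psi h2|s phi h].
- exact: (@represented_constraint _ true i j).
- exact: (@represented_constraint _ false i j).
- exact: represented_And.
- exact: represented_Comp.
exact: represented_Sub.
Qed.

End Formulas.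

Lemma links_sym (X : eqType) (c : constraint X) x y : links c x y = links c y x.
Proof. by rewrite /links orbC. Qed.

Lemma primal_sym (X : eqType) (C : seq (constraint X)) : symmetric (primal C).
Proof. by move=> x y; apply: eq_has => c; apply: links_sym. Qed.

(** * Contracting the equality constraints *)

Section Quotient.
Variables (X : finType) (C : seq (constraint X)).

Definition identified : rel X := fun x y => has (fun c => ~~ c.1.1 && links c x y) C.

Lemma identified_csym : connect_sym identified.
Proof.
by apply: sym_connect_sym => x y; apply: eq_has => c; rewrite links_sym.
Qed.

Definition rep : X -> X := fingraph.root identified.

Lemma rep_connect x y : (rep x == rep y) = connect identified x y.
Proof. exact: root_connect identified_csym x y. Qed.

Lemma rep_idem x : rep (rep x) == rep x.
Proof. by rewrite rep_connect identified_csym connect_root. Qed.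

Definition quotient_vertex : finType := {x : X | rep x == x}.

Definition cls (x : X) : quotient_vertex := exist _ (rep x) (rep_idem x).

Lemma cls_val (u : quotient_vertex) : cls (val u) = u.
Proof. by apply/val_inj/eqP; apply: (valP u). Qed.

Lemma cls_eq x y : (cls x == cls y) = connect identified x y.
Proof. exact: rep_connect. Qed.

Definition quotient_edge : rel quotient_vertex := fun u v =>
  has (fun c => c.1.1 && links (push cls c) u v) C.

Lemma quotient_edge_sym : symmetric quotient_edge.
Proof. by move=> u v; apply: eq_has => c; rewrite links_sym. Qed.

Definition quotient_graph : graph := Graph quotient_edge_sym.

Definition primal_graph : graph := Graph (primal_sym C).

Definition loop_free : bool := ~~ has (fun c => c.1.1 && (cls c.1.2 == cls c.2)) C.

(** The branch sets are the classes, connected by equality constraints. An edge constraint between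
    distinct members of a class would give a loop of the quotient without a loop in its branch set;
    [loop_free] excludes this. *)
Lemma quotient_minor : loop_free -> is_minor quotient_graph primal_graph.
Proof.
move=> lf; pose br (u : quotient_graph) : {set primal_graph} := [set x | cls x == u].
exists br; split.
- move=> u; split; first by apply/set0Pn; exists (val u); rewrite inE cls_val.
  move=> x y; rewrite !inE => /eqP xu /eqP yu.
  have : connect identified x y by rewrite -cls_eq xu yu.
  case/connectP=> p; elim: p x xu => [|z p IH] x xu /=; first by move=> _ ->.
  case/andP=> xz pth yl; apply: (@connect_trans _ _ z).
    have zu : cls z = u.
      by rewrite -xu; apply/esym/eqP; rewrite cls_eq connect1.
    apply: connect1; rewrite /= !inE xu zu eqxx /=.
    by apply: sub_has xz => c /andP[].
  apply: IH => //; rewrite -xu; apply/esym/eqP; by rewrite cls_eq connect1.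
- move=> u v uv; apply/pred0P => x; rewrite /= !inE; apply/negP.
  by case/andP=> /eqP-> /eqP e; rewrite e eqxx in uv.
- move=> u v _ /hasP[c cC /andP[_ /orP[]/andP[/eqP eu /eqP ev]]].
    exists c.1.2, c.2; rewrite !inE -eu -ev !eqxx; split=> //.
    by apply/hasP; exists c => //; rewrite /links !eqxx.
  exists c.2, c.1.2; rewrite !inE -eu -ev !eqxx; split=> //.
  by apply/hasP; exists c => //; rewrite /links !eqxx orbT.
move=> u /hasP[c cC /andP[ce lu]]; case/hasP: lf; exists c => //; rewrite ce /=.
by move: lu; rewrite /links orbb /= => /andP[/eqP-> /eqP->].
Qed.

Lemma satisfies_identified (G : graph) (f : X -> G) :
  all (satisfies f) C -> forall x y, connect identified x y -> f x = f y.
Proof.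
move=> /allP sf x y /connectP[p]; elim: p x => [|z p IH] x /=; first by move=> _ ->.
case/andP=> /hasP[c cC /andP[nc lc]] /IH{}IH /IH <-.
move: (sf c cC); rewrite /satisfies (negbTE nc) => /eqP.
by case/orP: lc => /andP[/eqP-> /eqP->].
Qed.

Lemma quotient_hom (G : graph) :
  Defs.hom quotient_graph G = \sum_(f : {ffun X -> G}) all (satisfies f) C.
Proof.
transitivity #|[set f : {ffun X -> G} | all (satisfies f) C]|; last first.
  by rewrite -sum1_card big_mkcond /=; apply: eq_bigr => f _; rewrite inE; case: all.
pose lift (g : {ffun quotient_graph -> G}) : {ffun X -> G} := [ffun x => g (cls x)].
rewrite /Defs.hom -(@card_imset _ _ lift); last first.
  move=> g g' /ffunP e; apply/ffunP => u.
  by have := e (val u); rewrite !ffunE cls_val.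
congr #|pred_of_set _|; apply/setP => f; rewrite inE; apply/imsetP/idP.
  case=> g; rewrite inE => /forallP hg ->; apply/allP => c cC.
  rewrite /satisfies !ffunE; case: ifP => cb.
    have /forallP/(_ (cls c.2))/implyP := hg (cls c.1.2); apply.
    by apply/hasP; exists c; rewrite // cb /links !eqxx.
  rewrite [cls _](_ : _ = cls c.2) //; apply/eqP; rewrite cls_eq connect1 //.
  by apply/hasP; exists c; rewrite // cb /links !eqxx.
move=> sf; have id := satisfies_identified sf.
exists [ffun u => f (val u)]; last first.
  by apply/ffunP => x; rewrite !ffunE; apply: id; apply: connect_root.
rewrite inE; apply/forallP => u; apply/forallP => v; apply/implyP.
case/hasP=> c cC /andP[cb lc]; rewrite !ffunE.
have fc x : f (val (cls x)) = f x by apply/esym/id; apply: connect_root.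
move: (allP sf c cC); rewrite /satisfies cb.
case/orP: lc => /andP[/eqP<- /eqP<-]; rewrite !fc //.
by rewrite edge_sym.
Qed.

Lemma unsatisfiable_loop (G : graph) (f : X -> G) :
  simple G -> ~~ loop_free -> all (satisfies f) C = false.
Proof.
move=> sG; rewrite negbK => /hasP[c cC /andP[cb ce]]; apply/negP => sf.
move: (allP sf c cC); rewrite /satisfies cb.
by rewrite (satisfies_identified sf (y := c.2)) ?sG // -cls_eq.
Qed.

End Quotient.

(** The form in which homomorphism indistinguishability is used for the converse. The sum over all
    labellings is the number of homomorphisms from the quotient graph, a member of the class; if
    that graph has a loop, both sums vanish because [G] and [H] are simple. *)
Lemma formula_sum t (G H : graph) (phi : formula t) : simple G -> simple H ->
  hom_indistinguishable (lasserre_class t) G H ->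
  \sum_(a : {ffun labels t -> G}) eval phi a =
  \sum_(a : {ffun labels t -> H}) eval phi a.
Proof.
move=> sG sH hGH; have [V [C [dC ev]]] := formula_represented phi.
have sumE (K : graph) : \sum_(a : {ffun labels t -> K}) eval phi a =
    \sum_(f : {ffun labels t + V -> K}) all (satisfies f) C.
  by rewrite [RHS]sum_join; apply: eq_bigr => a _; rewrite ev.
rewrite !sumE; have [lf|nlf] := boolP (loop_free C); last first.
  by rewrite !big1 // => f _; rewrite unsatisfiable_loop.
rewrite -!quotient_hom; apply: hGH.
apply: lasserre_class_minor_closed (quotient_minor lf).
by exists (label_set t V).
Qed.

(** * From solutions of the system to homomorphism counts *)

Import Order.TTheory GRing.Theory Num.Theory.
Local Open Scope ring_scope.

(** * Null vectors of the moment matrix and marginals *)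

Section PsdFamily.
Variables (R : realType) (X : finType) (t : nat) (y : {set X} -> R).
Hypothesis y_psd : psd (moment_matrix t y).

Lemma psd_family (K : finType) (s : K -> {set X}) (c : K -> R) :
  (forall k, #|s k| <= t)%N ->
  0 <= \sum_k \sum_l c k * c l * y (s k :|: s l).
Proof.
move=> hs; have sI k : s k \in subsets_upto X t by rewrite inE.
pose ix k := enum_rank_in (sI k) (s k).
have ixE k : enum_val (ix k) = s k by apply: enum_rankK_in.
pose x : 'cV[R]_#|subsets_upto X t| := \sum_k c k *: delta_mx (ix k) 0.
have [_ /(_ x)] := y_psd; congr (0 <= _).
have xT : x^T = \sum_k c k *: delta_mx 0 (ix k).
  rewrite /x raddf_sum; apply: eq_bigr => k _.
  by apply/matrixP=> i j; rewrite !mxE andbC.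
rewrite xT !mulmx_suml summxE; apply: eq_bigr => k _.
rewrite -!scalemxAl mxE /x mulmx_sumr summxE big_distrr.
apply: eq_bigr => l _; rewrite /= -scalemxAr mxE mulrA; congr (_ * _).
by rewrite -rowE -colE !mxE !ixE.
Qed.

(** A vector of length 0 is orthogonal to everything: adding [u] times it to the vector of [J]
    changes the quadratic form to [2 u b + y J], which is nonnegative for all [u] only if
    [b = 0]. *)
Lemma psd_null (K : finType) (s : K -> {set X}) (c : K -> R) :
  (forall k, #|s k| <= t)%N ->
  \sum_k \sum_l c k * c l * y (s k :|: s l) = 0 ->
  forall J : {set X}, (#|J| <= t)%N -> \sum_k c k * y (s k :|: J) = 0.
Proof.
move=> hs h0 J hJ; set b := \sum_k _.
pose s' (k : K + unit) := match k with inl k => s k | inr _ => J end.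
have pos u : 0 <= u * b + (u * b + y J).
  pose c' (k : K + unit) := match k with inl k => u * c k | inr _ => 1 end.
  have := @psd_family _ s' c'; rewrite !big_sumType /=.
  rewrite [X in _ + X](_ : _ = u * b + y J); last first.
    rewrite (big_pred1 tt) // big_sumType /= (big_pred1 tt) // !mul1r setUid.
    rewrite /b big_distrr /=; congr (_ + _); apply: eq_bigr => k _.
    by rewrite mul1r setUC mulrA.
  rewrite [X in X + _](_ : _ = u * b); first by apply; case.
  under eq_bigr => k _ do rewrite big_sumType /= (big_pred1 tt) // mulr1.
  rewrite big_split /= [X in X + _](_ : _ = 0) ?add0r.
    by rewrite /b big_distrr; apply: eq_bigr => k _ /=; rewrite mulrA.
  rewrite -[RHS](mulr0 (u ^+ 2)) -[in RHS]h0 big_distrr; apply: eq_bigr => k _ /=.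
  by rewrite big_distrr; apply: eq_bigr => l _ /=; ring.
have [//|b0] := eqVneq b 0.
(* This [u] makes the form equal to [-1]. *)
have := pos (- (y J + 1) / (2 * b)).
have -> : - (y J + 1) / (2 * b) * b = - (y J + 1) / 2 by field.
lra.
Qed.

End PsdFamily.

Section Support.
Variables (D B : finType).

(* Partial functions on [U] are encoded as total ones with the junk value [b0]
   outside of [U]. *)
Definition supp_on (b0 : B) (U : {set D}) : pred {ffun D -> B} :=
  fun q => [forall x, (x \notin U) ==> (q x == b0)].

Lemma supp_onP b0 (U : {set D}) (q : {ffun D -> B}) :
  reflect (forall x, x \notin U -> q x = b0) (supp_on b0 U q).
Proof.
by apply: (iffP forallP) => h x; [move=> xU; apply/eqP; move: (h x); rewrite xU
  | apply/implyP => xU; rewrite h].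
Qed.

Definition update (q : {ffun D -> B}) (x : D) (b : B) : {ffun D -> B} :=
  [ffun z => if z == x then b else q z].

Definition restrict b0 (U : {set D}) (q : {ffun D -> B}) : {ffun D -> B} :=
  [ffun z => if z \in U then q z else b0].

Lemma restrict_supp b0 U q : supp_on b0 U (restrict b0 U q).
Proof. by apply/supp_onP => x /negbTE xU; rewrite ffunE xU. Qed.

Lemma supp_on_eq b0 U (p q : {ffun D -> B}) : supp_on b0 U p ->
  supp_on b0 U q -> {in U, p =1 q} -> p = q.
Proof.
move=> /supp_onP hp /supp_onP hq h; apply/ffunP => x.
by have [xU|xU] := boolP (x \in U); [apply: h|rewrite hp ?hq].
Qed.

Lemma supp_on_setT b0 q : supp_on b0 [set: D] q.
Proof. by apply/supp_onP => x; rewrite inE. Qed.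

Lemma sum_supp_insert (M : nmodType) b0 (U : {set D}) x
    (f : {ffun D -> B} -> M) : x \notin U ->
  \sum_(q | supp_on b0 (x |: U) q) f q =
  \sum_b \sum_(q | supp_on b0 U q) f (update q x b).
Proof.
move=> xU; rewrite pair_big_dep /=.
rewrite (reindex_onto (fun bq => update bq.2 x bq.1)
  (fun q => (q x, update q x b0))) /=; last first.
  move=> q _; apply/ffunP => z; rewrite !ffunE.
  by have [->|] := eqVneq z x.
apply: eq_bigl => -[b q] /=; apply/andP/idP.
  case=> /supp_onP h /eqP[_ <-]; apply/supp_onP => z zU.
  rewrite ffunE; have [//|zx] := eqVneq z x.
  by apply: h; rewrite !inE negb_or zx.
move=> /supp_onP h; split.
  apply/supp_onP => z; rewrite !inE negb_or ffunE => /andP[/negbTE->].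
  exact: h.
apply/eqP; congr (_, _); first by rewrite ffunE eqxx.
apply/ffunP => z; rewrite !ffunE; have [->|//] := eqVneq z x.
by rewrite h.
Qed.

End Support.

Section Marginals.
Variables (R : realType) (T A B : finType) (t : nat) (y : {set T} -> R).
Variable pr : A -> B -> T.

Hypothesis t_gt0 : (0 < t)%N.
Hypothesis y_null : forall (K : finType) (s : K -> {set T}) (c : K -> R),
  (forall k, #|s k| <= t)%N ->
  \sum_k \sum_l c k * c l * y (s k :|: s l) = 0 ->
  forall J : {set T}, (#|J| <= t)%N -> \sum_k c k * y (s k :|: J) = 0.
Hypothesis y_sum : forall (I : {set T}) a, (#|I| <= 2 * t - 2)%N ->
  \sum_b y (I :|: [set pr a b]) = y I.
Hypothesis y_orth : forall (I : {set T}) a b b', (#|I| <= 2 * t)%N ->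
  b != b' -> pr a b \in I -> pr a b' \in I -> y I = 0.

(** The constraints stop at size [2t - 2]; positive semidefiniteness supplies size [2t - 1]. Split
    [I] into [I1] of size at most [t - 1] and [I2] of size at most [t]. The vectors of [I1 :|:
    [set pr a b]], summed over [b], minus the vector of [I1] have length 0 by [y_sum] and [y_orth];
    pairing with [I2] gives the claim. *)
Lemma marginal_one (I : {set T}) a : (#|I| <= 2 * t - 1)%N ->
  \sum_b y (I :|: [set pr a b]) = y I.
Proof.
move=> hI.
pose I1 := [set x in take t.-1 (enum I)].
pose I2 := [set x in drop t.-1 (enum I)].
have eI : I = I1 :|: I2.
  by apply/setP => x; rewrite !inE -mem_cat cat_take_drop mem_enum.
have c1 : (#|I1| <= t.-1)%N.
  by rewrite cardsE (leq_trans (card_size _)) // size_take_min geq_minl.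
have c2 : (#|I2| <= t)%N.
  rewrite cardsE (leq_trans (card_size _)) // size_drop -cardE.
  rewrite leq_subLR; apply: (leq_trans hI); lia.
pose s (k : B + unit) :=
  match k with inl b => I1 :|: [set pr a b] | inr _ => I1 end.
pose c (k : B + unit) : R := match k with inl b => 1 | inr _ => -1 end.
have hs k : (#|s k| <= t)%N.
  case: k => [b|_] /=; last by lia.
  have : (#|[set pr a b]| <= 1)%N by rewrite cards1.
  by move/(cardsU_le c1); lia.
have I1s : \sum_b y (I1 :|: [set pr a b]) = y I1 by apply: y_sum; lia.
have inner k : \sum_l c l * y (s k :|: s l) = 0.
  rewrite big_sumType /= (big_pred1 tt) // mulN1r.
  under eq_bigr => b _ do rewrite mul1r.
  apply/eqP; rewrite subr_eq0; apply/eqP; case: k => [b|_] /=; last first.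
    by rewrite setUid -I1s; apply: eq_bigr => b _; rewrite setUA setUid.
  rewrite (bigD1 b) //= setUid big1 ?addr0; first by rewrite setUAC setUid.
  move=> b' bb'; apply: (@y_orth _ a b b'); rewrite ?inE ?eqxx ?orbT //.
    by rewrite mul2n -addnn cardsU_le ?(hs (inl b)) ?(hs (inl b')).
  by rewrite eq_sym.
have h0 : \sum_k \sum_l c k * c l * y (s k :|: s l) = 0.
  apply: big1 => k _; rewrite -[RHS](mulr0 (c k)) -[in RHS](inner k) big_distrr.
  by apply: eq_bigr => l _ /=; rewrite mulrA.
have := y_null hs h0 c2.
rewrite big_sumType /= (big_pred1 tt) // mulN1r -eI => /eqP.
rewrite subr_eq0 => /eqP <-; apply: eq_bigr => b _.
by rewrite mul1r setUAC -eI.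
Qed.

Definition pairing (D : finType) (U : {set D}) (p : {ffun D -> A})
  (q : {ffun D -> B}) : {set T} := [set pr (p x) (q x) | x in U].

(** Sums out one point of [U] at a time. The map [pr] is pairing in either order, so the result
    applies to both families of linear constraints. *)
Lemma marginal (D : finType) (b0 : B) (U : {set D}) (J : {set T})
    (p : {ffun D -> A}) : (#|U| + #|J| <= 2 * t)%N ->
  \sum_(q | supp_on b0 U q) y (J :|: pairing U p q) = y J.
Proof.
have [n] := ubnP #|U|; elim: n U J => // n IH U J Un hUJ.
have [U0|[x xU]] := set_0Vmem U.
  rewrite (big_pred1 [ffun=> b0]) => [|q].
    by rewrite /pairing U0 imset0 setU0.
  apply/supp_onP/eqP => [h|-> z _]; last by rewrite ffunE.
  by apply/ffunP => z; rewrite ffunE h // U0 inE.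
have cU := cardsD1 x U; rewrite xU in cU.
rewrite -(setD1K xU) sum_supp_insert ?setD11 // exchange_big /=.
rewrite -(IH (U :\ x)) //; try lia.
apply: eq_bigr => q _; rewrite -(@marginal_one _ (p x)); last first.
  have := leq_imset_card (fun x => pr (p x) (q x)) (U :\ x).
  by move/(cardsU_le (leqnn #|J|)); rewrite -/(pairing _ p q); lia.
apply: eq_bigr => b _; congr y; rewrite -setUA; congr (_ :|: _).
rewrite /pairing imsetU1 ffunE eqxx setUC; congr (_ :|: _).
apply: eq_in_imset => z; rewrite !inE ffunE => /andP[/negbTE-> _] //.
Qed.

End Marginals.

(** * Support conditions and intertwining relations *)

Section Intertwining.
Variables (R : realType) (t : nat) (D G H : finType) (y : {set G * H} -> R).
Variables (g0 : G) (h0 : H).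

Local Notation im U p q := [set (p x, q x) | x in U].
Local Notation suppG := (supp_on g0).
Local Notation suppH := (supp_on h0).

Hypothesis y_null : forall (K : finType) (s : K -> {set G * H}) (c : K -> R),
  (forall k, #|s k| <= t)%N ->
  \sum_k \sum_l c k * c l * y (s k :|: s l) = 0 ->
  forall J : {set G * H}, (#|J| <= t)%N -> \sum_k c k * y (s k :|: J) = 0.
Hypothesis y_margH : forall (U : {set D}) (J : {set G * H}) (p : {ffun D -> G}),
  (#|U| + #|J| <= 2 * t)%N ->
  \sum_(q | suppH U q) y (J :|: im U p q) = y J.
Hypothesis y_margG : forall (U : {set D}) (J : {set G * H}) (q : {ffun D -> H}),
  (#|U| + #|J| <= 2 * t)%N ->
  \sum_(p | suppG U p) y (J :|: im U p q) = y J.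
Hypothesis y_orthH : forall (I : {set G * H}) g h h', (#|I| <= 2 * t)%N ->
  h != h' -> (g, h) \in I -> (g, h') \in I -> y I = 0.
Hypothesis y_orthG : forall (I : {set G * H}) h g g', (#|I| <= 2 * t)%N ->
  g != g' -> (g, h) \in I -> (g', h) \in I -> y I = 0.
Hypothesis y_ge0 : forall I : {set G * H}, (#|I| <= 2 * t)%N -> 0 <= y I.

Implicit Types (U V W : {set D}).

Local Notation fG := {ffun D -> G}.
Local Notation fH := {ffun D -> H}.

Let im_card U (p : fG) (q' : fH) : (#|im U p q'| <= #|U|)%N.
Proof. exact: leq_imset_card. Qed.

Let imU_card U V (p q : fG) (p' q' : fH) : (#|U| <= t)%N -> (#|V| <= t)%N ->
  (#|im U p p' :|: im V q q'| <= 2 * t)%N.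
Proof.
move=> hU hV; rewrite mul2n -addnn.
by apply: cardsU_le; [apply: leq_trans hU|apply: leq_trans hV]; apply: im_card.
Qed.

Lemma im_orthG U (p q : fG) (q' : fH) : (#|U| <= t)%N -> suppG U p -> suppG U q -> p != q ->
  y (im U p q' :|: im U q q') = 0.
Proof.
move=> hU sp sq npq.
have [x /andP[xU pqx]|h] := pickP [pred x | (x \in U) && (p x != q x)]; last first.
  case/eqP: npq; apply: (supp_on_eq sp sq) => x xU.
  by have := h x; rewrite /= xU => /negbFE/eqP.
apply: (@y_orthG _ (q' x) (p x) (q x)) => //; first exact: imU_card.
  by rewrite inE; apply/orP; left; apply/imsetP; exists x.
by rewrite inE; apply/orP; right; apply/imsetP; exists x.
Qed.

Lemma im_orthH U (p : fG) (q q' : fH) : (#|U| <= t)%N -> suppH U q -> suppH U q' -> q != q' ->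
  y (im U p q :|: im U p q') = 0.
Proof.
move=> hU sp sq npq.
have [x /andP[xU pqx]|h] := pickP [pred x | (x \in U) && (q x != q' x)]; last first.
  case/eqP: npq; apply: (supp_on_eq sp sq) => x xU.
  by have := h x; rewrite /= xU => /negbFE/eqP.
apply: (@y_orthH _ (p x) (q x) (q' x)) => //; first exact: imU_card.
  by rewrite inE; apply/orP; left; apply/imsetP; exists x.
by rewrite inE; apply/orP; right; apply/imsetP; exists x.
Qed.

Definition same_where_supported U W (X : fG -> fG -> R)
    (X' : fH -> fH -> R) : Prop :=
  forall (p : fG) (p' : fH) (q : fG) (q' : fH),
    suppG U p -> suppH U p' -> suppG W q -> suppH W q' ->
    y (im U p p' :|: im W q q') != 0 -> X p q = X' p' q'.

(** For a Gram representation [v] of the moment matrix, this equates the sum of [X p q] times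
    [v (q, q')] with the sum of [X' p' q'] times [v (p, p')], tested against every [v J]. *)
Definition intertwined U W (X : fG -> fG -> R)
    (X' : fH -> fH -> R) : Prop :=
  forall (p : fG) (q' : fH) (J : {set G * H}), suppG U p -> suppH W q' -> (#|J| <= t)%N ->
    \sum_(q | suppG W q) X p q * y (im W q q' :|: J) =
    \sum_(p' | suppH U p') X' p' q' * y (im U p p' :|: J).

(** The difference of the two vectors is orthogonal to each vector occurring in it, so it has length
    0. Indeed, vectors on the same side are orthogonal, and across the sides the support condition
    allows [X' p' q'] to be replaced by [X p q], after which a marginal sum remains. *)
Lemma same_intertwined U W X X' : (#|U| <= t)%N -> (#|W| <= t)%N ->
  same_where_supported U W X X' -> intertwined U W X X'.
Proof.
move=> hU hW hX p q' J sp sq' hJ.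
pose s (k : fG + fH) :=
  match k with inl q => im W q q' | inr p' => im U p p' end.
pose c (k : fG + fH) := match k with
  | inl q => if suppG W q then X p q else 0
  | inr p' => if suppH U p' then - X' p' q' else 0 end.
have sumE (J' : {set G * H}) : \sum_l c l * y (s l :|: J') =
    \sum_(q | suppG W q) X p q * y (im W q q' :|: J') -
    \sum_(p' | suppH U p') X' p' q' * y (im U p p' :|: J').
  rewrite big_sumType /= -sumrN (big_mkcond (suppG W)) (big_mkcond (suppH U)).
  congr (_ + _); apply: eq_bigr => q _; case: ifP => _; rewrite ?mul0r //.
  by rewrite mulNr.
have hs k : (#|s k| <= t)%N.
  by case: k => k /=; [apply: leq_trans hW|apply: leq_trans hU]; apply: im_card.
have rows k : c k * \sum_l c l * y (s k :|: s l) = 0.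
  under eq_bigr do rewrite setUC; rewrite sumE.
  case: k => [q|p'] /=; case: ifP => sk; rewrite ?mul0r //.
    rewrite (bigD1 q) //= setUid big1 ?addr0 => [|q2 /andP[sq2 nq]]; last first.
      by rewrite im_orthG ?mulr0.
    rewrite [X in _ - X](_ : _ = X p q * y (im W q q')) ?subrr ?mulr0 //.
    rewrite -(@y_margH U _ p) 1?addnC; last first.
      rewrite mul2n -addnn leq_add //; apply: leq_trans hW; exact: im_card.
    rewrite big_distrr; apply: eq_bigr => p' sp' /=; rewrite setUC.
    have [->|nz] := eqVneq (y (im W q q' :|: im U p p')) 0; first by rewrite !mulr0.
    by rewrite (hX p p' q q') // setUC.
  rewrite [X in _ - X](bigD1 p') //= setUid [X in _ - (_ + X)]big1 ?addr0;
    last first.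
    by move=> q2 /andP[sq2 nq]; rewrite im_orthH ?mulr0.
  rewrite [X in X - _](_ : _ = X' p' q' * y (im U p p')) ?subrr ?mulr0 //.
  rewrite -(@y_margG W _ q') 1?addnC; last first.
    rewrite mul2n -addnn leq_add //; apply: leq_trans hU; exact: im_card.
  rewrite big_distrr; apply: eq_bigr => q sq /=; rewrite setUC.
  have [->|nz] := eqVneq (y (im U p p' :|: im W q q')) 0; first by rewrite !mulr0.
  by rewrite (hX p p' q q').
have /(y_null hs)/(_ J hJ) : \sum_k \sum_l c k * c l * y (s k :|: s l) = 0.
  apply: big1 => k _; rewrite -[RHS](rows k) big_distrr.
  by apply: eq_bigr => l _ /=; rewrite mulrA.
by rewrite sumE => /eqP; rewrite subr_eq0 => /eqP.
Qed.

(** Apply the relation for [Y] to each vector indexed by [W] on the left, exchange sums, and then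
    apply the relation for [X]. *)
Lemma intertwined_comp U W V X X' Y Y' :
  intertwined U W X X' -> intertwined W V Y Y' ->
  intertwined U V (fun p r => \sum_(q | suppG W q) X p q * Y q r)
                  (fun p' r' => \sum_(q' | suppH W q') X' p' q' * Y' q' r').
Proof.
move=> hX hY p r' J sp sr' hJ.
transitivity (\sum_(q | suppG W q) X p q *
    \sum_(q' | suppH W q') Y' q' r' * y (im W q q' :|: J)).
  under eq_bigr => r _ do rewrite big_distrl /=.
  rewrite exchange_big /=; apply: eq_bigr => q sq.
  by rewrite -hY // big_distrr /=; apply: eq_bigr => r _; rewrite mulrA.
under eq_bigr => q _ do rewrite big_distrr /=.
rewrite exchange_big /=.
under [RHS]eq_bigr => p' _ do rewrite big_distrl /=.
rewrite [RHS]exchange_big /=; apply: eq_bigr => q' sq'.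
transitivity (Y' q' r' * \sum_(q | suppG W q) X p q * y (im W q q' :|: J)).
  by rewrite big_distrr; apply: eq_bigr => q _ /=; rewrite mulrCA.
by rewrite hX // big_distrr; apply: eq_bigr => p' _ /=; rewrite mulrCA mulrA.
Qed.

(* Both row sums of the nonnegative family
   [y (p,p',r,r') * (Z p r - Z' p' r')^2] vanish. *)
Lemma intertwined_same U V Z Z' : (#|U| <= t)%N -> (#|V| <= t)%N ->
  intertwined U V Z Z' -> same_where_supported U V Z Z'.
Proof.
move=> hU hV hZ p p0' r0 r' sp sp0' sr0 sr'.
pose m (p' : fH) (r : fG) := y (im U p p' :|: im V r r').
have cU (p1 : fG) (p' : fH) : (#|im U p1 p'| <= t)%N by apply: leq_trans hU; apply: im_card.
have cV (r1 : fG) : (#|im V r1 r'| <= t)%N by apply: leq_trans hV; apply: im_card.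
have sum_r p' : suppH U p' ->
    \sum_(r | suppG V r) m p' r * (Z p r - Z' p' r') = 0.
  move=> sp'; under eq_bigr => r _ do rewrite mulrBr [m p' r * Z p r]mulrC.
  rewrite sumrB -big_distrl /= /m y_margG; last first.
    by rewrite mul2n -addnn leq_add.
  under eq_bigr => r _ do rewrite setUC.
  rewrite hZ // (bigD1 p') //= setUid big1 ?addr0 => [|q' /andP[sq' nq]].
    by rewrite mulrC subrr.
  by rewrite im_orthH ?mulr0.
have sum_p r : suppG V r ->
    \sum_(p' | suppH U p') m p' r * (Z p r - Z' p' r') = 0.
  move=> sr; under eq_bigr => p' _ do rewrite mulrBr [m p' r * Z' p' r']mulrC.
  rewrite sumrB -big_distrl /= /m.
  under eq_bigr => p' _ do rewrite setUC.
  rewrite y_margH; last by rewrite mul2n -addnn leq_add.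
  rewrite -hZ // (bigD1 r) //= setUid big1 ?addr0 => [|q' /andP[sq' nq]].
    by rewrite mulrC subrr.
  by rewrite im_orthG ?mulr0.
have sq0 : \sum_(r | suppG V r) \sum_(p' | suppH U p')
    m p' r * (Z p r - Z' p' r') ^+ 2 = 0.
  transitivity (\sum_(r | suppG V r) Z p r * \sum_(p' | suppH U p')
       m p' r * (Z p r - Z' p' r') -
     \sum_(p' | suppH U p') Z' p' r' * \sum_(r | suppG V r)
       m p' r * (Z p r - Z' p' r')).
    under [X in _ - X]eq_bigr => p' _ do rewrite big_distrr /=.
    rewrite [X in _ - X]exchange_big /= -sumrB; apply: eq_bigr => r sr.
    rewrite big_distrr /= -sumrB; apply: eq_bigr => p' sp'.
    by rewrite expr2; ring.
  by rewrite !big1 ?subrr // => [p' sp'|r sr]; rewrite ?sum_r ?sum_p ?mulr0.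
have m_ge0 p' r : 0 <= m p' r * (Z p r - Z' p' r') ^+ 2.
  by rewrite mulr_ge0 ?sqr_ge0 // y_ge0 // imU_card.
move=> nz; apply/eqP; rewrite -subr_eq0 -[_ == 0]sqrf_eq0.
have : m p0' r0 * (Z p r0 - Z' p0' r') ^+ 2 = 0.
  have /psumr_eq0P/(_ sq0 r0 sr0) : forall r, suppG V r ->
      0 <= \sum_(p' | suppH U p') m p' r * (Z p r - Z' p' r') ^+ 2.
    by move=> r _; apply: sumr_ge0.
  by move/psumr_eq0P; apply.
by move/eqP; rewrite mulf_eq0 (negbTE nz).
Qed.

End Intertwining.

(** * Counting extensions along a decomposition *)

Section CountExtensions.
Variables (F G : graph) (g0 : G).
Implicit Types (S B C U V W : {set F}) (a f q w : {ffun F -> G}).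

Local Notation supp := (supp_on g0).

Definition hom_on S f : bool :=
  [forall x in S, forall y in S, edge x y ==> edge (f x) (f y)].

Definition agree B f a : bool := [forall x in B, f x == a x].

Definition count_ext S B a : nat :=
  #|[pred f | [&& supp S f, hom_on S f & agree B f a]]|.

Definition glue U f a : {ffun F -> G} := [ffun x => if x \in U then f x else a x].

Lemma hom_onP S f : reflect
  {in S &, forall x y, edge x y -> edge (f x) (f y)} (hom_on S f).
Proof.
apply: (iffP forall_inP) => [h x y xS yS exy|h x xS].
  by have /forall_inP/(_ _ yS)/implyP := h x xS; apply.
by apply/forall_inP => y yS; apply/implyP; apply: h.
Qed.

Lemma agreeP B f a : reflect {in B, f =1 a} (agree B f a).
Proof. by apply: (iffP forall_inP) => h x xB; apply/eqP; apply: h. Qed.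

Lemma hom_on_agree S f a : agree S f a -> hom_on S f = hom_on S a.
Proof.
move=> /agreeP fa; apply/hom_onP/hom_onP => h x y xS yS /(h _ _ xS yS).
  by rewrite !fa.
by rewrite !fa.
Qed.

Lemma count_ext_agree S B a a' : agree B a a' -> count_ext S B a = count_ext S B a'.
Proof.
move=> /agreeP aa; apply: eq_card => f; rewrite !inE; congr [&& _, _ & _].
by apply/agreeP/agreeP => h x xB; rewrite h ?aa.
Qed.

Lemma count_ext_refine S B C a : B \subset C -> C \subset S ->
  count_ext S B a = (\sum_(q | supp C q && agree B q a) count_ext S C q)%N.
Proof.
move=> /subsetP BC /subsetP CS; rewrite /count_ext -sum1_card.
rewrite (partition_big (restrict g0 C) (fun q => supp C q && agree B q a)) /=.
  apply: eq_bigr => q /andP[sq /agreeP qa]; rewrite -sum1_card.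
  apply: eq_bigl => f; rewrite !inE /= -!andbA; congr [&& _, _ & _].
  apply/andP/agreeP => [[/agreeP fa /eqP <-] x xC|fq].
    by rewrite ffunE xC.
  split; first by apply/agreeP => x xB; rewrite fq ?qa ?BC.
  apply/eqP/(supp_on_eq _ sq); first exact: restrict_supp.
  by move=> x xC; rewrite ffunE xC fq.
move=> f /and3P[_ _ /agreeP fa]; rewrite restrict_supp.
by apply/agreeP => x xB; rewrite ffunE BC ?fa.
Qed.

(** Once the values on [C1 :|: C2] are fixed, the two parts extend independently, since they meet
    only there. The factor [hom_on B q] accounts for edges inside [B] that belong to neither
    part. *)
Lemma count_ext_glue S1 S2 C1 C2 B q : C1 \subset S1 -> C2 \subset S2 ->
  B \subset C1 :|: C2 -> S1 :&: S2 \subset C1 :&: C2 ->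
  edges_split (@edge F) S1 S2 B ->
  count_ext (S1 :|: S2) (C1 :|: C2) q =
  (hom_on B q * (count_ext S1 C1 q * count_ext S2 C2 q))%N.
Proof.
move=> /subsetP s1 /subsetP s2 /subsetP sB sI es; have jM := join_meet sI.
have [hB|nhB] := boolP (hom_on B q); last first.
  rewrite mul0n; apply/eqP/pred0P => f /=; apply/negbTE/negP.
  case/and3P=> _ /hom_onP h /agreeP fq; case/negP: nhB.
  apply/hom_onP => x y xB yB exy.
  have BS z : z \in B -> z \in S1 :|: S2.
    by move/sB; rewrite !inE => /orP[/s1|/s2] ->; rewrite ?orbT.
  by rewrite -!fq ?sB //; apply: h => //; apply: BS.
rewrite mul1n /count_ext -!sum1_card big_distrlr /= pair_big /=.
rewrite (reindex_onto (fun fg => glue S1 fg.1 fg.2)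
   (fun f => (restrict g0 S1 f, restrict g0 S2 f))) /=; last first.
  move=> f /and3P[/supp_onP sf _ _]; apply/ffunP => x; rewrite !ffunE.
  have [//|x1] := boolP (x \in S1); have [//|x2] := boolP (x \in S2).
  by rewrite sf // inE negb_or x1.
rewrite muln1; apply: eq_bigl => -[f1 f2] /=; apply/idP/idP.
  case/andP=> /and3P[/supp_onP sf /hom_onP hf /agreeP fq] /eqP[e1 e2].
  have g1 x : x \in S1 -> f1 x = glue S1 f1 f2 x by move=> x1; rewrite ffunE x1.
  have g2 x : x \in S2 -> f2 x = glue S1 f1 f2 x.
    by move=> x2; rewrite -{1}e2 ffunE x2.
  have sf1 : supp S1 f1 by rewrite -e1 restrict_supp.
  have sf2 : supp S2 f2 by rewrite -e2 restrict_supp.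
  rewrite !inE sf1 sf2 /=; apply/andP; split; apply/andP; split.
  - apply/hom_onP => x y x1 y1 exy; rewrite !g1 //.
    by apply: hf; rewrite ?inE ?x1 ?y1.
  - by apply/agreeP => x xC; rewrite g1 ?s1 // fq // inE xC.
  - apply/hom_onP => x y x1 y1 exy; rewrite !g2 //.
    by apply: hf; rewrite ?inE ?x1 ?y1 ?orbT.
  by apply/agreeP => x xC; rewrite g2 ?s2 // fq // inE xC orbT.
rewrite !inE => /andP[/and3P[sf1 /hom_onP h1 /agreeP q1]].
case/and3P=> [sf2 /hom_onP h2 /agreeP q2].
have g1 x : x \in S1 -> glue S1 f1 f2 x = f1 x by move=> x1; rewrite ffunE x1.
have g2 x : x \in S2 -> glue S1 f1 f2 x = f2 x.
  move=> x2; rewrite ffunE; case: ifP => // x1.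
  by rewrite q1 ?q2 ?(jM x).
have gq : {in C1 :|: C2, glue S1 f1 f2 =1 q}.
  move=> x; rewrite inE => /orP[xC|xC]; first by rewrite g1 ?q1 ?s1.
  by rewrite g2 ?q2 ?s2.
apply/andP; split; last first.
  apply/eqP; congr (_, _).
    by apply: supp_on_eq sf1 _; [exact: restrict_supp|move=> x xS; rewrite ffunE xS g1].
  by apply: supp_on_eq sf2 _; [exact: restrict_supp|move=> x xS; rewrite ffunE xS g2].
apply/and3P; split; last by apply/agreeP.
  apply/supp_onP => x; rewrite !inE negb_or ffunE => /andP[/negbTE-> x2].
  by rewrite (supp_onP _ _ _ sf2).
apply/hom_onP => x y xS yS exy.
case/or3P: (es _ _ exy xS yS) => /andP[hx hy].
- by rewrite !g1 //; apply: h1.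
- by rewrite !g2 //; apply: h2.
by rewrite !gq ?sB //; apply: (hom_onP _ _ hB).
Qed.

(** Turns the count into a matrix indexed by maps on [U] and maps on [W]; since [U] and [W] may
    overlap, inconsistent pairs get the entry 0. *)
Definition glue_count S U W p w : nat :=
  if agree (U :&: W) p w then count_ext S (U :|: W) (glue U p w) else 0.

(** Composition of parts becomes a matrix product over the maps on [W], up to the factor for edges
    inside [U :|: V]. *)
Lemma count_ext_series S1 S2 U V W a :
  U :|: W \subset S1 -> W :|: V \subset S2 ->
  S1 :&: S2 \subset (U :|: W) :&: (W :|: V) ->
  edges_split (@edge F) S1 S2 (U :|: V) ->
  count_ext (S1 :|: S2) (U :|: V) a =
  (hom_on (U :|: V) a * \sum_(w | supp W w)
     glue_count S1 U W (restrict g0 U a) w *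
     glue_count S2 W V w (restrict g0 V a))%N.
Proof.
move=> s1 s2 sI es.
have sB : U :|: V \subset (U :|: W) :|: (W :|: V).
  by apply/subsetP => x; rewrite !inE => /orP[] ->; rewrite ?orbT.
rewrite (count_ext_refine _ sB (setUSS s1 s2)) big_distrr /=.
under eq_bigr => q /andP[_ qa]
  do rewrite (count_ext_glue _ s1 s2 sB sI es) (hom_on_agree qa).
rewrite (reindex_onto (glue (U :|: V) a) (restrict g0 W)) /=; last first.
  move=> q /andP[/supp_onP sq /agreeP qa]; apply/ffunP => x; rewrite !ffunE.
  have [xB|xB] := boolP (x \in _); first by rewrite qa.
  have [//|xW] := boolP (x \in W); rewrite sq //.
  by move: xB; rewrite !inE !negb_or xW => /andP[-> ->].
(* Maps [w] that contradict [a] on the overlap contribute 0 by the test in [glue_count]; the others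
   correspond to the [q] on the left. *)
rewrite [RHS](bigID (fun w => agree (W :&: (U :|: V)) w a)) /=.
rewrite [X in (_ + X)%N]big1 ?addn0; last first.
  move=> w /andP[sw nw]; rewrite /glue_count.
  case: ifP => [/agreeP h1|_]; last by rewrite mul0n muln0.
  case: ifP => [/agreeP h2|_]; last by rewrite !muln0.
  case/negP: nw; apply/agreeP => x; rewrite !inE => /andP[xW /orP[xU|xV]].
    by rewrite -h1 ?inE ?xU // ffunE xU.
  by rewrite h2 ?inE ?xW // ffunE xV.
apply: eq_big => w.
  apply/idP/idP.
    case/andP=> /andP[/supp_onP sg _] /eqP rw.
    rewrite -{1}rw restrict_supp /=; apply/agreeP => x; rewrite inE => /andP[xW xB].
    by rewrite -rw !ffunE xW xB.
  case/andP=> /supp_onP sw /agreeP wa; apply/andP; split; first (apply/andP; split).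
  - apply/supp_onP => x; rewrite ffunE => xC.
    rewrite ifF ?sw //; first by apply: contra xC; rewrite !inE => ->; rewrite orbT.
    apply: contraNF xC; exact: (subsetP sB).
  - by apply/agreeP => x xB; rewrite ffunE xB.
  apply/eqP/ffunP => x; rewrite !ffunE; case: ifP => xW; last by rewrite sw ?xW.
  by case: ifP => // xB; rewrite wa // inE xW.
case/andP=> /andP[_ _] /eqP rw.
have wa x : x \in W -> x \in U :|: V -> w x = a x.
  by move=> xW xB; rewrite -rw !ffunE xW xB.
congr (_ * (_ * _))%N; rewrite /glue_count.
  rewrite ifT; last first.
    by apply/agreeP => x; rewrite inE ffunE => /andP[xU xW]; rewrite xU wa // inE xU.
  apply: count_ext_agree; apply/agreeP => x; rewrite inE !ffunE.
  have [xU _|xU /= xW] := boolP (x \in U); first by rewrite inE xU.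
  by case: ifP => // xB; rewrite wa.
rewrite ifT; last first.
  by apply/agreeP => x; rewrite inE ffunE => /andP[xW xV]; rewrite xV wa // inE xV orbT.
apply: count_ext_agree; apply/agreeP => x; rewrite inE !ffunE.
have [xW _|xW /= xV] := boolP (x \in W); last by rewrite inE xV orbT.
by case: ifP => // xB; rewrite wa.
Qed.

Lemma hom_count_ext a : Defs.hom F G = count_ext [set: F] set0 a.
Proof.
rewrite /Defs.hom cardsE; apply: eq_card => f; rewrite !inE supp_on_setT /=.
rewrite [agree _ _ _](_ : _ = true) ?andbT; last by apply/agreeP => x; rewrite inE.
apply/forallP/hom_onP => [h x y _ _ exy|h x].
  by have /forallP/(_ y)/implyP := h x; apply.
by apply/forallP => y; apply/implyP; apply: h; rewrite inE.
Qed.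

End CountExtensions.

Lemma im_glue (F G H : graph) (U W : {set F}) (p w : {ffun F -> G})
    (p' w' : {ffun F -> H}) : agree (U :&: W) p w -> agree (U :&: W) p' w' ->
  [set (glue U p w x, glue U p' w' x) | x in U :|: W] =
  [set (p x, p' x) | x in U] :|: [set (w x, w' x) | x in W].
Proof.
move=> /agreeP h /agreeP h'; rewrite imsetU; congr (_ :|: _); apply: eq_in_imset.
  by move=> x xU; rewrite !ffunE xU.
by move=> x xW; rewrite !ffunE; case: ifP => // xU; rewrite h ?h' // inE xU.
Qed.

(** * Transfer of extension counts from [G] to [H] *)

Section LasserreToHom.
Variables (R : realType) (t : nat) (G H : graph) (y : {set G * H} -> R).
Hypothesis t_gt0 : (0 < t)%N.
Hypothesis y_psd : psd (moment_matrix t y).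
Hypothesis y_sumH : forall (I : {set G * H}) (g : G), (#|I| <= 2 * t - 2)%N ->
  \sum_(h : H) y (I :|: [set (g, h)]) = y I.
Hypothesis y_sumG : forall (I : {set G * H}) (h : H), (#|I| <= 2 * t - 2)%N ->
  \sum_(g : G) y (I :|: [set (g, h)]) = y I.
Hypothesis y_iso : forall I : {set G * H}, (#|I| <= 2 * t)%N -> ~~ partial_iso I ->
  y I = 0.
Hypothesis y_empty : y set0 = 1.
Hypothesis y_ge0 : forall I : {set G * H}, (#|I| <= 2 * t)%N -> 0 <= y I.

Lemma partial_iso_supp (I : {set G * H}) : (#|I| <= 2 * t)%N -> y I != 0 ->
  {in I &, forall u v, (u.1 == v.1) = (u.2 == v.2) /\ edge u.1 v.1 = edge u.2 v.2}.
Proof.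
move=> hI yI u v uI vI; have [/forall_inP h|/(y_iso hI) y0] := boolP (partial_iso I).
  by have /forall_inP/(_ v vI)/andP[/eqP h1 /eqP h2] := h u uI.
by rewrite y0 eqxx in yI.
Qed.

Lemma partial_iso_orthH (I : {set G * H}) g h h' : (#|I| <= 2 * t)%N ->
  h != h' -> (g, h) \in I -> (g, h') \in I -> y I = 0.
Proof.
move=> hI hh i1 i2; apply/eqP; apply: contraNT hh => nz.
by have [] := partial_iso_supp hI nz i1 i2; rewrite /= eqxx => <-.
Qed.

Lemma partial_iso_orthG (I : {set G * H}) h g g' : (#|I| <= 2 * t)%N ->
  g != g' -> (g, h) \in I -> (g', h) \in I -> y I = 0.
Proof.
move=> hI hh i1 i2; apply/eqP; apply: contraNT hh => nz.
by have [] := partial_iso_supp hI nz i1 i2; rewrite /= eqxx => ->.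
Qed.

Variable F : graph.
Variables (g0 : G) (h0 : H).
Implicit Types (U V W S B : {set F}).

Local Notation im U p q := [set (p x, q x) | x in U].

Lemma lasserre_marginalH U (J : {set G * H}) (p : {ffun F -> G}) :
  (#|U| + #|J| <= 2 * t)%N ->
  \sum_(q | supp_on h0 U q) y (J :|: im U p q) = y J.
Proof.
exact: (marginal t_gt0 (psd_null y_psd) y_sumH partial_iso_orthH).
Qed.

Lemma lasserre_marginalG U (J : {set G * H}) (q : {ffun F -> H}) :
  (#|U| + #|J| <= 2 * t)%N ->
  \sum_(p | supp_on g0 U p) y (J :|: im U p q) = y J.
Proof.
exact: (@marginal _ _ _ _ _ _ (fun h g => (g, h)) t_gt0 (psd_null y_psd)
  y_sumG partial_iso_orthG).
Qed.

(** The value at the smaller set is a sum of nonnegative values at larger sets, one of which is the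
    value at [im B a b]. *)
Lemma supported_subset B B' (a : {ffun F -> G}) (b : {ffun F -> H}) :
  (#|B| <= 2 * t)%N -> B' \subset B -> y (im B a b) != 0 -> y (im B' a b) != 0.
Proof.
move=> hB sB; apply: contra => /eqP y0.
have cI : (#|B :\: B'| + #|im B' a b| <= 2 * t)%N.
  apply: leq_trans hB; rewrite -(cardsID B' B) addnC leq_add2r (setIidPr sB).
  exact: leq_imset_card.
have imE (q : {ffun F -> H}) : {in B :\: B', q =1 b} ->
    im B' a b :|: im (B :\: B') a q = im B a b.
  move=> qb; rewrite -[in RHS](setID B B') (setIidPr sB) imsetU; congr (_ :|: _).
  by apply: eq_in_imset => x xB; rewrite qb.
have := lasserre_marginalH a cI; rewrite y0 => /psumr_eq0P.
move=> /(_ _ (restrict h0 (B :\: B') b) (restrict_supp _ _ _)); rewrite imE => [->//|].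
  move=> q _; apply: y_ge0; apply: leq_trans cI; rewrite addnC.
  by apply: cardsU_le => //; apply: leq_imset_card.
by move=> x xB; rewrite ffunE xB.
Qed.

Lemma hom_on_transfer B (a : {ffun F -> G}) (b : {ffun F -> H}) :
  (#|B| <= 2 * t)%N -> y (im B a b) != 0 -> hom_on B a = hom_on B b.
Proof.
move=> hB nz.
have cI : (#|im B a b| <= 2 * t)%N by apply: leq_trans hB; apply: leq_imset_card.
have key x z : x \in B -> z \in B -> edge (a x) (a z) = edge (b x) (b z).
  move=> xB zB.
  by have [] := partial_iso_supp cI nz (imset_f _ xB) (imset_f _ zB).
by apply/hom_onP/hom_onP => h x z xB zB /(h _ _ xB zB); rewrite key.
Qed.

Lemma glue_count_transfer S U W : (#|U| <= t)%N -> (#|W| <= t)%N ->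
  (forall (a : {ffun F -> G}) (b : {ffun F -> H}), y (im (U :|: W) a b) != 0 ->
     count_ext g0 S (U :|: W) a = count_ext h0 S (U :|: W) b) ->
  same_where_supported y g0 h0 U W
    (fun p q => (glue_count g0 S U W p q)%:R)
    (fun p q => (glue_count h0 S U W p q)%:R).
Proof.
move=> hU hW IH p p' q q' _ _ _ _ nz; congr _%:R; rewrite /glue_count.
have cI : (#|im U p p' :|: im W q q'| <= 2 * t)%N.
  rewrite mul2n -addnn; apply: cardsU_le.
    by apply: leq_trans hU; apply: leq_imset_card.
  by apply: leq_trans hW; apply: leq_imset_card.
have ag : agree (U :&: W) p q = agree (U :&: W) p' q'.
  have key x : x \in U :&: W -> (p x == q x) = (p' x == q' x).
    rewrite inE => /andP[xU xW].
    have i1 : (p x, p' x) \in im U p p' :|: im W q q'.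
      by rewrite inE; apply/orP; left; apply/imsetP; exists x.
    have i2 : (q x, q' x) \in im U p p' :|: im W q q'.
      by rewrite inE; apply/orP; right; apply/imsetP; exists x.
    by have [] := partial_iso_supp cI nz i1 i2.
  by apply: eq_forallb_in => x xI; rewrite key.
rewrite -ag; case: ifP => // a1; apply: IH.
by rewrite im_glue // -ag.
Qed.

Lemma count_ext_transfer S B : dec t (@edge F) S B ->
  forall (a : {ffun F -> G}) (b : {ffun F -> H}), y (im B a b) != 0 ->
  count_ext g0 S B a = count_ext h0 S B b.
Proof.
elim=> {S B} [B hB|S1 S2 B1 B2 B d1 IH1 d2 IH2 nB sI es] a b nz.
  have baseE (K : graph) (k0 : K) (c : {ffun F -> K}) :
      count_ext k0 B B c = hom_on B c.
    rewrite /count_ext; have [hc|nhc] := boolP (hom_on B c).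
      rewrite -[RHS](card1 (restrict k0 B c)); apply: eq_card => f; rewrite !inE.
      apply/and3P/eqP => [[sf _ /agreeP fc]|->].
        apply: (supp_on_eq sf (restrict_supp _ _ _)) => x xB.
        by rewrite ffunE xB fc.
      have ag : agree B (restrict k0 B c) c.
        by apply/agreeP => x xB; rewrite ffunE xB.
      by rewrite restrict_supp (hom_on_agree ag).
    apply/eqP/pred0P => f /=; apply/negP => /and3P[_ hf /hom_on_agree fc].
    by rewrite -fc hf in nhc.
  by rewrite !baseE (hom_on_transfer hB nz).
have hB := dec_card (dec_join d1 d2 nB sI es).
case: nB sI es => [[e1 e2]|[U [V [W [hU hV hW [e1 e2 eB]]]]]] sI es.
  subst B1; have s1 := dec_sub d1; have s2 := dec_sub d2.
  have sB : B \subset B :|: B2 by apply: subsetUl.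
  rewrite -[in LHS](setUidPl e2) -[in RHS](setUidPl e2).
  rewrite !(count_ext_glue _ _ s1 s2 sB sI es) (hom_on_transfer hB nz) (IH1 _ _ nz).
  by rewrite (IH2 _ _ (supported_subset hB e2 nz)).
subst B1 B2 B; have s1 := dec_sub d1; have s2 := dec_sub d2.
rewrite !(count_ext_series _ _ s1 s2 sI es) (hom_on_transfer hB nz).
congr (_ * _)%N; apply/eqP; rewrite -(eqr_nat R) !natr_sum; apply/eqP.
under eq_bigr do rewrite natrM; under [RHS]eq_bigr do rewrite natrM.
(* The support condition for matrices is not visibly stable under products, so both factors are
   turned into intertwining relations, composed, and turned back. *)
have tw1 := same_intertwined (psd_null y_psd) lasserre_marginalH
  lasserre_marginalG partial_iso_orthH partial_iso_orthG hU hW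
  (glue_count_transfer hU hW IH1).
have tw2 := same_intertwined (psd_null y_psd) lasserre_marginalH
  lasserre_marginalG partial_iso_orthH partial_iso_orthG hW hV
  (glue_count_transfer hW hV IH2).
have := intertwined_same lasserre_marginalH lasserre_marginalG partial_iso_orthH
  partial_iso_orthG y_ge0 hU hV (intertwined_comp tw1 tw2).
apply; rewrite ?restrict_supp //.
apply: contra nz => /eqP nz; apply/eqP; rewrite -nz imsetU; congr (y (_ :|: _)).
  by apply: eq_in_imset => x xU; rewrite !ffunE xU.
by apply: eq_in_imset => x xU; rewrite !ffunE xU.
Qed.

(** The numbers [y (im B q q')] couple the maps on [B] into [G] with those into [H], with all
    marginals 1, and the extension counts agree on the support. *)
Lemma lasserre_hom_inhabited : lasserre_class t F -> Defs.hom F G = Defs.hom F H.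
Proof.
case=> B d; have hB := dec_card d.
rewrite (hom_count_ext g0 [ffun=> g0]) (hom_count_ext h0 [ffun=> h0]).
rewrite !(@count_ext_refine _ _ _ _ set0 B) ?sub0set ?subsetT //.
have ag (K : graph) (k0 : K) q a : supp_on k0 B q && agree set0 q a = supp_on k0 B q.
  by rewrite [agree _ _ _](_ : _ = true) ?andbT; last by apply/agreeP => x; rewrite inE.
under eq_bigl do rewrite ag; under [RHS]eq_bigl do rewrite ag.
apply/eqP; rewrite -(eqr_nat R) !natr_sum; apply/eqP.
transitivity (\sum_(q | supp_on g0 B q) \sum_(q' | supp_on h0 B q')
    (count_ext g0 [set: F] B q)%:R * y (set0 :|: im B q q')).
  apply: eq_bigr => q _; rewrite -big_distrr /= lasserre_marginalH ?cards0 ?addn0 //.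
  by rewrite y_empty mulr1.
rewrite exchange_big /=; apply: eq_bigr => q' _.
rewrite -[RHS]mulr1 -y_empty -(@lasserre_marginalG B set0 q') ?cards0 ?addn0 //.
rewrite big_distrr; apply: eq_bigr => q _ /=; rewrite set0U.
have [->|nz] := eqVneq (y (im B q q')) 0; first by rewrite !mulr0.
by rewrite (count_ext_transfer d nz).
Qed.

End LasserreToHom.

Lemma lasserre_hom (R : realType) (t : nat) (G H : graph) : (0 < t)%N ->
  lasserre_plus R t G H -> hom_indistinguishable (lasserre_class t) G H.
Proof.
move=> t0 [y [yp ysH ysG yi [y0 yge]]] F LF.
have c0 : (#|(set0 : {set G * H})| <= 2 * t - 2)%N by rewrite cards0.
(* If just one of the graphs were empty, a sum over the empty set would equal [y set0 = 1]. *)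
have [g0 _|G0] := pickP (predT : pred G).
  have [h0 _|H0] := pickP (predT : pred H).
    exact: (lasserre_hom_inhabited t0 yp ysH ysG yi y0 yge g0 h0).
  have := ysH set0 g0 c0; rewrite big_pred0 => [|h].
    by rewrite y0 => /eqP; rewrite eq_sym oner_eq0.
  by have := H0 h.
have [h0 _|H0] := pickP (predT : pred H).
  have := ysG set0 h0 c0; rewrite big_pred0 => [|g].
    by rewrite y0 => /eqP; rewrite eq_sym oner_eq0.
  by have := G0 g.
have emptyE (K : graph) : predT =1 (pred0 : pred K) -> Defs.hom F K = (#|F| == 0)%N.
  move=> K0; rewrite /Defs.hom.
  have [/eqP/card0_eq F0|] := boolP (_ == _).
    apply: (etrans (eq_card (_ : _ =i predT))); last first.
      rewrite card_ffun (eq_card0 F0) expn0 //.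
    by move=> f; rewrite !inE; apply/forallP => x; have := F0 x; rewrite inE.
  rewrite -lt0n => /card_gt0P[x _]; apply/eqP; rewrite cards_eq0.
  by apply/eqP/setP => f; have := K0 (f x).
by rewrite !emptyE.
Qed.

(** * From homomorphism counts to a solution of the system *)

Section SameType.
Variable t : nat.

Definition same_type (K K' : graph) (a : {ffun labels t -> K})
    (b : {ffun labels t -> K'}) : bool := `[< forall phi, eval phi a = eval phi b >].

Lemma same_typeP (K K' : graph) (a : {ffun labels t -> K})
    (b : {ffun labels t -> K'}) :
  reflect (forall phi, eval phi a = eval phi b) (same_type a b).
Proof. exact: asboolP. Qed.

Lemma same_type_refl (K : graph) (a : {ffun labels t -> K}) : same_type a a.
Proof. exact/same_typeP. Qed.

Lemma same_type_sym (K K' : graph) (a : {ffun labels t -> K})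
    (b : {ffun labels t -> K'}) : same_type a b = same_type b a.
Proof. by apply/same_typeP/same_typeP => h phi; rewrite h. Qed.

Lemma same_type_trans (K K' K'' : graph) (a : {ffun labels t -> K})
    (b : {ffun labels t -> K'}) (c : {ffun labels t -> K''}) :
  same_type a b -> same_type a c = same_type b c.
Proof.
by move=> /same_typeP ab; apply/same_typeP/same_typeP => h phi; rewrite -h ab.
Qed.

Definition reindex_labels (K : graph) (s : {ffun labels t -> labels t})
  (a : {ffun labels t -> K}) : {ffun labels t -> K} := [ffun i => a (s i)].

Lemma same_type_reindex (K K' : graph) s (a : {ffun labels t -> K})
    (b : {ffun labels t -> K'}) :
  same_type a b -> same_type (reindex_labels s a) (reindex_labels s b).
Proof. by move=> /same_typeP h; apply/same_typeP => phi; apply: (h (FSub s phi)). Qed.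

Lemma same_type_eq (K K' : graph) (a : {ffun labels t -> K})
    (b : {ffun labels t -> K'}) i j : same_type a b -> (a i == a j) = (b i == b j).
Proof. by move=> /same_typeP/(_ (FEq i j)) /=; do 2!case: eqP. Qed.

Lemma same_type_edge (K K' : graph) (a : {ffun labels t -> K})
    (b : {ffun labels t -> K'}) i j :
  same_type a b -> edge (a i) (a j) = edge (b i) (b j).
Proof. by move=> /same_typeP/(_ (FEdge i j)) /=; do 2!case: edge. Qed.

Definition type_size (K G : graph) (c : {ffun labels t -> K}) : nat :=
  #|[pred a : {ffun labels t -> G} | same_type c a]|.

Lemma type_size_eq (K K' G : graph) (c : {ffun labels t -> K})
    (d : {ffun labels t -> K'}) :
  same_type c d -> type_size G c = type_size G d.
Proof.
by move=> cd; apply: eq_card => a; rewrite !inE; apply: same_type_trans.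
Qed.

Lemma type_size_gt0 (K : graph) (c : {ffun labels t -> K}) : (0 < type_size K c)%N.
Proof. by apply/card_gt0P; exists c; rewrite inE same_type_refl. Qed.

End SameType.

(** * The algebra of definable functions of labels *)

Section LabelAlgebra.
Variables (R : realType) (t : nat) (G H : graph).
Hypothesis t_gt0 : (0 < t)%N.
Hypothesis formula_sums : forall phi : formula t,
  (\sum_(a : {ffun labels t -> G}) eval phi a =
   \sum_(b : {ffun labels t -> H}) eval phi b)%N.

Local Notation TG := {ffun labels t -> G}.
Local Notation TH := {ffun labels t -> H}.

Definition combination (L : seq (R * formula t)) (K : graph)
    (a : {ffun labels t -> K}) : R := \sum_(c <- L) c.1 * (eval c.2 a)%:R.

(** A [combination] is a quantum graph with labels; the same one has to give [X] on [G] and [X'] on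
    [H]. *)
Definition definable (X : TG -> R) (X' : TH -> R) : Prop :=
  exists L, X =1 combination L (K := G) /\ X' =1 combination L (K := H).

Lemma eq_definable X X' Y Y' : X =1 Y -> X' =1 Y' ->
  definable X X' -> definable Y Y'.
Proof.
by move=> e e' [L [h h']]; exists L; split=> a; rewrite -?e -?e' ?h ?h'.
Qed.

Lemma definable_formula phi :
  definable (fun a => (eval phi a)%:R) (fun b => (eval phi b)%:R).
Proof.
by exists [:: (1, phi)]; split=> a; rewrite /combination big_seq1 mul1r.
Qed.

Lemma definable_add X X' Y Y' : definable X X' -> definable Y Y' ->
  definable (fun a => X a + Y a) (fun b => X' b + Y' b).
Proof.
case=> L [h h'] [L2 [k k']]; exists (L ++ L2).
by split=> a; rewrite /combination big_cat /= ?h ?h' ?k ?k'.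
Qed.

Lemma definable_scale r X X' : definable X X' ->
  definable (fun a => r * X a) (fun b => r * X' b).
Proof.
case=> L [h h']; exists [seq (r * c.1, c.2) | c <- L].
by split=> a; rewrite ?h ?h' /combination big_map big_distrr;
   apply: eq_bigr => c _ /=; rewrite mulrA.
Qed.

Let label0 : labels t := inl (Ordinal t_gt0).

Lemma definable_const r : definable (fun=> r) (fun=> r).
Proof.
by apply: eq_definable (definable_scale r (definable_formula (FEq label0 label0)))
  => a /=; rewrite eqxx mulr1.
Qed.

Lemma combination_bilinear (op : formula t -> formula t -> formula t) L L2
    (K : graph) (a : {ffun labels t -> K}) :
  combination [seq (c.1 * d.1, op c.2 d.2) | c <- L, d <- L2] a =
  \sum_(c <- L) \sum_(d <- L2) c.1 * d.1 * (eval (op c.2 d.2) a)%:R.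
Proof. by rewrite /combination big_allpairs_dep. Qed.

Lemma definable_mul X X' Y Y' : definable X X' -> definable Y Y' ->
  definable (fun a => X a * Y a) (fun b => X' b * Y' b).
Proof.
case=> L [h h'] [L2 [k k']].
exists [seq (c.1 * d.1, FAnd c.2 d.2) | c <- L, d <- L2].
by split=> a; rewrite combination_bilinear ?h ?h' ?k ?k' /combination
  big_distrlr; apply: eq_bigr => c _; apply: eq_bigr => d _ /=;
  rewrite natrM; ring.
Qed.

Lemma definable_comp X X' Y Y' : definable X X' -> definable Y Y' ->
  definable (fun a => \sum_w X (join (lpart a) w) * Y (join w (rpart a)))
            (fun b => \sum_w X' (join (lpart b) w) * Y' (join w (rpart b))).
Proof.
case=> L [h h'] [L2 [k k']].
exists [seq (c.1 * d.1, FComp c.2 d.2) | c <- L, d <- L2].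
have bil (K : graph) (a : {ffun labels t -> K}) :
    \sum_w combination L (join (lpart a) w) * combination L2 (join w (rpart a)) =
    combination [seq (c.1 * d.1, FComp c.2 d.2) | c <- L, d <- L2] a.
  rewrite combination_bilinear /combination.
  under eq_bigr => w _ do rewrite big_distrlr /=.
  rewrite exchange_big /=; apply: eq_bigr => c _.
  rewrite exchange_big /=; apply: eq_bigr => d _.
  rewrite natr_sum big_distrr; apply: eq_bigr => w _ /=.
  by rewrite natrM; ring.
by split=> a; rewrite -bil; apply: eq_bigr => w _; rewrite ?h ?h' ?k ?k'.
Qed.

Lemma definable_reindex s X X' : definable X X' ->
  definable (fun a => X (reindex_labels s a)) (fun b => X' (reindex_labels s b)).
Proof.
case=> L [h h']; exists [seq (c.1, FSub s c.2) | c <- L].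
by split=> a; rewrite ?h ?h' /combination big_map.
Qed.

Lemma definable_prod (I : Type) (s : seq I) (X : I -> TG -> R) (X' : I -> TH -> R) :
  (forall i, definable (X i) (X' i)) ->
  definable (fun a => \prod_(i <- s) X i a) (fun b => \prod_(i <- s) X' i b).
Proof.
move=> h; elim: s => [|i s IH].
  by apply: eq_definable (definable_const 1) => a; rewrite big_nil.
by apply: eq_definable (definable_mul (h i) IH) => a; rewrite big_cons.
Qed.

Lemma definable_sum X X' : definable X X' -> \sum_a X a = \sum_b X' b.
Proof.
case=> L [h h']; under eq_bigr do rewrite h.
under [RHS]eq_bigr do rewrite h'.
rewrite /combination exchange_big [RHS]exchange_big; apply: eq_bigr => c _.
by rewrite -!big_distrr -!natr_sum formula_sums.
Qed.

Lemma definable_same_type_GG X X' (a a' : TG) : definable X X' -> same_type a a' ->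
  X a = X a'.
Proof.
case=> L [h h'] /same_typeP aa; rewrite !h.
by apply: eq_bigr => c _; rewrite aa.
Qed.

Lemma definable_same_type_HH X X' (b b' : TH) : definable X X' -> same_type b b' ->
  X' b = X' b'.
Proof.
case=> L [h h'] /same_typeP aa; rewrite !h'.
by apply: eq_bigr => c _; rewrite aa.
Qed.

Lemma definable_same_type X X' (a : TG) (b : TH) : definable X X' ->
  same_type a b -> X a = X' b.
Proof.
case=> L [h h'] /same_typeP ab; rewrite h h'.
by apply: eq_bigr => c _; rewrite ab.
Qed.

(* Lagrange interpolation: for each tuple [z] of another type than [c], an
   affine function of a formula is 1 at [c] and 0 at [z]. *)
Lemma definable_type (K : graph) (c : {ffun labels t -> K}) :
  definable (fun a => (same_type c a)%:R) (fun b => (same_type c b)%:R).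
Proof.
have sep (K' : graph) : exists phi : {ffun labels t -> K'} -> formula t,
    forall z, ~~ same_type c z -> eval (phi z) c != eval (phi z) z.
  apply: (@fin_all_exists _ (fun=> formula t)
    (fun z phi => ~~ same_type c z -> eval phi c != eval phi z)) => z.
  have [_|/asboolPn/existsNP[phi h]] := boolP (same_type c z).
    by exists (FEq label0 label0).
  by exists phi => _; apply/eqP.
have [[phi phiP] [psi psiP]] := (sep G, sep H).
pose fac (f : formula t) (v : nat) (x : nat) : R :=
  if v == eval f c then 1 else (x%:R - v%:R) / ((eval f c)%:R - v%:R).
have fac_def f v : definable (fun a => fac f v (eval f a)) (fun b => fac f v (eval f b)).
  rewrite /fac; case: eqP => _; first exact: definable_const.
  by apply: eq_definable (definable_scale ((eval f c)%:R - v%:R)^-1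
    (definable_add (definable_formula f) (definable_const (- v%:R)))) => a;
    rewrite mulrC.
have fac1 f v x : x = eval f c -> fac f v x = 1.
  rewrite /fac => ->; case: eqP => // /eqP nv; rewrite divff //.
  by rewrite subr_eq0 eqr_nat eq_sym.
have fac0 f v : eval f c != v -> fac f v v = 0.
  by rewrite /fac eq_sym => /negbTE->; rewrite subrr mul0r.
have := definable_mul
  (definable_prod (index_enum TG) (fun z => fac_def (phi z) (eval (phi z) z)))
  (definable_prod (index_enum TH) (fun z => fac_def (psi z) (eval (psi z) z))).
apply: eq_definable => z.
  have [cz|ncz] := boolP (same_type c z).
    rewrite !big1 ?mulr1 // => z' _; apply: fac1; apply/esym;
    exact: (same_typeP _ _ cz).
  rewrite [X in X * _](bigD1 z) //= fac0 ?mul0r //.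
  exact: phiP.
have [cz|ncz] := boolP (same_type c z).
  rewrite !big1 ?mulr1 // => z' _; apply: fac1; apply/esym;
  exact: (same_typeP _ _ cz).
rewrite [X in _ * X](bigD1 z) //= fac0 ?mul0r ?mulr0 //.
exact: psiP.
Qed.

Lemma type_sizeE (K : graph) (c : {ffun labels t -> K}) (K' : graph) :
  \sum_(a : {ffun labels t -> K'}) (same_type c a)%:R = (type_size K' c)%:R :> R.
Proof.
rewrite -natr_sum; congr _%:R; rewrite /type_size -sum1_card [RHS]big_mkcond.
by apply: eq_bigr => a _; rewrite inE; case: same_type.
Qed.

Lemma type_size_GH (K : graph) (c : {ffun labels t -> K}) :
  type_size G c = type_size H c.
Proof.
by apply/eqP; rewrite -(eqr_nat R) -!type_sizeE (definable_sum (definable_type c)).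
Qed.

(** Summing out one label is composition with the formula [E k], which equates all left and right
    labels except those of index [k]. *)
Lemma definable_forget (i : labels t) X X' : definable X X' ->
  definable (fun a => \sum_g X (update a i g)) (fun b => \sum_h X' (update b i h)).
Proof.
move=> dX.
pose E (k : 'I_t) : formula t := foldr (@FAnd t) (FEq label0 label0)
  [seq FEq (inl k') (inr k') | k' <- enum 'I_t & k' != k].
have EE (k : 'I_t) (K : graph) (u w : {ffun 'I_t -> K}) :
    eval (E k) (join u w) = [forall (k' | k' != k), u k' == w k'].
  have -> : [forall (k' | k' != k), u k' == w k'] =
      all (fun k' => u k' == w k') [seq k' <- enum 'I_t | k' != k].
    apply/forall_inP/allP => h k'; first by rewrite mem_filter => /andP[/h].
    by move=> kk; apply: h; rewrite mem_filter kk mem_enum.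
  rewrite /E; elim: [seq _ <- _ | _] => [|k' s IH] /=; first by rewrite eqxx.
  by rewrite IH !ffunE mulnb.
have sumE (k : 'I_t) (K : graph) (u : {ffun 'I_t -> K}) (F : {ffun 'I_t -> K} -> R) :
    \sum_(w : {ffun 'I_t -> K} | [forall (k' | k' != k), u k' == w k']) F w =
    \sum_g F (update u k g).
  rewrite (reindex_onto (update u k) (fun w => w k)) /=.
    apply: eq_bigl => g; rewrite ffunE eqxx eqxx andbT.
    by apply/forall_inP => k' /negbTE kk; rewrite ffunE kk.
  move=> w /forall_inP h; apply/ffunP => k'; rewrite ffunE.
  by have [->|/h/eqP] := eqVneq k' k.
have boolE (b : bool) (r : R) : (b : nat)%:R * r = if b then r else 0.
  by case: b; rewrite ?mul1r ?mul0r.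
case: i => k.
  by apply: eq_definable (definable_comp (definable_formula (E k)) dX) => a /=;
  under eq_bigr do rewrite EE boolE; rewrite -big_mkcond sumE;
  apply: eq_bigr => g _; congr (_ _); apply/ffunP => -[k'|k']; rewrite !ffunE.
have EE' (K : graph) (u w : {ffun 'I_t -> K}) :
    eval (E k) (join w u) = [forall (k' | k' != k), u k' == w k'].
  by rewrite EE; congr nat_of_bool; apply: eq_forallb_in => k' _; rewrite eq_sym.
by apply: eq_definable (definable_comp dX (definable_formula (E k))) => a /=;
  under eq_bigr do rewrite EE' mulrC boolE; rewrite -big_mkcond sumE;
  apply: eq_bigr => g _; congr (_ _); apply/ffunP => -[k'|k']; rewrite !ffunE.
Qed.

End LabelAlgebra.

Definition coupling (R : realType) (t : nat) (G H : graph)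
    (a : {ffun labels t -> G}) (b : {ffun labels t -> H}) : R :=
  if same_type a b then (type_size G a)%:R^-1 else 0.
Arguments coupling : clear implicits.
Arguments coupling R {t G H} a b.

(** Maps that agree outside [i] are grouped together; each group has exactly one member with equal
    values at [i] and [j]. *)
Lemma sum_update_split (M : nmodType) (D B : finType) (i j : D)
    (F : {ffun D -> B} -> M) : j != i ->
  \sum_c F c = \sum_(c : {ffun D -> B} | c i == c j) \sum_g F (update c i g).
Proof.
move=> ji; rewrite pair_big_dep /=.
rewrite (reindex_onto (fun cg => update cg.1 i cg.2)
  (fun c => (update c i (c j), c i))) /=; last first.
  by move=> c _; apply/ffunP => x; rewrite !ffunE; case: eqP => // ->.
apply: eq_bigl => -[c g] /=; rewrite andbT !ffunE eqxx (negbTE ji).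
apply/eqP/eqP => [[<-]|cc]; first by rewrite !ffunE eqxx (negbTE ji).
congr (_, _); apply/ffunP => x; rewrite !ffunE.
by have [->|//] := eqVneq x i.
Qed.

(** * The coupling of tuples of the same type *)

Section Coupling.
Variables (R : realType) (t : nat) (G H : graph).
Hypothesis t_gt0 : (0 < t)%N.
Hypothesis formula_sums : forall phi : formula t,
  (\sum_(a : {ffun labels t -> G}) eval phi a =
   \sum_(b : {ffun labels t -> H}) eval phi b)%N.

Local Notation TG := {ffun labels t -> G}.
Local Notation TH := {ffun labels t -> H}.
Implicit Types (a : TG) (b : TH).

Lemma same_type_size a b : same_type a b -> type_size G a = type_size H b.
Proof.
move=> ab; rewrite (type_size_eq _ ab).
exact: (type_size_GH R t_gt0 formula_sums).
Qed.

Lemma coupling_ge0 a b : 0 <= coupling R a b.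
Proof. by rewrite /coupling; case: ifP => // _; rewrite invr_ge0. Qed.

Lemma coupling_swap a b : coupling R a b = coupling R b a.
Proof.
rewrite /coupling same_type_sym; case: ifP => // ab.
by rewrite (@same_type_size a b) // same_type_sym.
Qed.

Lemma coupling_mass a : \sum_(b : TH) coupling R a b = 1.
Proof.
rewrite /coupling -big_mkcond /= sumr_const -[LHS]mulr_natr.
rewrite [#|_|](_ : _ = type_size G a); last first.
  by rewrite (type_size_GH R t_gt0 formula_sums).
by rewrite mulVf // pnatr_eq0 -lt0n type_size_gt0.
Qed.

Definition merge_label (i j : labels t) : {ffun labels t -> labels t} :=
  [ffun x => if x == i then j else x].

Lemma reindex_merge (K : graph) i j (c : {ffun labels t -> K}) :
  reindex_labels (merge_label i j) c = update c i (c j).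
Proof. by apply/ffunP => x; rewrite !ffunE; case: eqP. Qed.

Lemma update_update (K : graph) i g g' (c : {ffun labels t -> K}) :
  update (update c i g) i g' = update c i g'.
Proof. by apply/ffunP => x; rewrite !ffunE; case: eqP. Qed.

(** Let [m] be the number of values at [i] that give the type of [a]. By [definable_forget] it
    depends only on the type of the merged tuple [a1], so the type of [a] has [m] times as many
    tuples as that of [a1], and the left side is [m] divided by this product. *)
Lemma coupling_marginal i j a b : j != i ->
  \sum_h coupling R a (update b i h) =
  coupling R (update a i (a j)) (update b i (b j)).
Proof.
move=> ji.
have dU := definable_forget t_gt0 i (definable_type R G H t_gt0 a).
set a1 := update a i (a j); set b1 := update b i (b j).
have merge (K : graph) (c : {ffun labels t -> K}) g :
    same_type a (update c i g) -> same_type a1 (update c i (c j)).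
  move/(same_type_reindex (merge_label i j)); rewrite !reindex_merge update_update.
  by rewrite ffunE (negbTE ji).
pose m : R := \sum_g (same_type a (update a i g))%:R.
have sumE : \sum_h coupling R a (update b i h) =
    (\sum_h (same_type a (update b i h))%:R) / (type_size G a)%:R.
  rewrite big_distrl; apply: eq_bigr => h _; rewrite /coupling /=.
  by case: same_type; rewrite ?mul1r ?mul0r.
rewrite sumE /coupling; have [ab1|nab1] := boolP (same_type a1 b1); last first.
  rewrite big1 ?mul0r // => h _; case: (boolP (same_type _ _)) => // /merge.
  by rewrite (negbTE nab1).
have -> : \sum_h (same_type a (update b i h))%:R = m.
  have := definable_same_type dU ab1.
  under eq_bigr do rewrite update_update.
  by under [X in _ = X -> _]eq_bigr do rewrite update_update.
have sz : (type_size G a)%:R = (type_size G a1)%:R * m.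
  rewrite -(type_sizeE R a G) (sum_update_split _ ji).
  rewrite -(type_sizeE R a1 G) big_distrl /= big_mkcond; apply: eq_bigr => c _.
  case: eqP => [cc|cc]; last first.
    case: (boolP (same_type _ _)) => [/(same_type_eq i j)|]; last by rewrite mul0r.
    by rewrite !ffunE eqxx (negbTE ji) eqxx => /esym/eqP.
  have c1 : update c i (c j) = c.
    by apply/ffunP => x; rewrite ffunE; case: eqP => // ->.
  have [ac|nac] := boolP (same_type a1 c); rewrite ?mul0r ?mul1r.
    have := definable_same_type_GG dU ac => /= <-.
    by under eq_bigr do rewrite update_update.
  apply: big1 => g _; case: (boolP (same_type _ _)) => // /merge.
  by rewrite c1 (negbTE nac).
have : (type_size G a)%:R != 0 :> R by rewrite pnatr_eq0 -lt0n type_size_gt0.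
rewrite sz mulf_eq0 negb_or => /andP[s0 m0].
by rewrite invfM mulrCA mulfV ?mulr1.
Qed.

(** The type of a tuple records which entries coincide, so a renaming that can be undone on [a] can
    be undone on all tuples of its type and is injective there. *)
Lemma type_size_reindex (K : graph) (a : {ffun labels t -> K}) s u :
  reindex_labels u (reindex_labels s a) = a ->
  type_size K (reindex_labels s a) = type_size K a.
Proof.
have half (c : {ffun labels t -> K}) s' u' :
    reindex_labels u' (reindex_labels s' c) = c ->
    (type_size K c <= type_size K (reindex_labels s' c))%N.
  move=> /ffunP suc; rewrite /type_size -(@card_in_image _ _ (reindex_labels s')).
    apply: subset_leq_card; apply/subsetP => _ /imageP[d cd ->].
    by rewrite inE; apply: same_type_reindex.
  move=> d d' cd cd' /ffunP e; apply/ffunP => i.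
  have key (d0 : {ffun labels t -> K}) : same_type c d0 -> d0 i = d0 (s' (u' i)).
    move=> cd0; apply/eqP; rewrite -(same_type_eq _ _ cd0).
    by have := suc i; rewrite !ffunE => ->.
  rewrite !key //.
  by have := e (u' i); rewrite !ffunE.
move=> sua; apply/eqP; rewrite eqn_leq (half _ s u) // andbT.
have {2}<- := sua; apply: (half _ u s).
by rewrite sua.
Qed.

Lemma coupling_reindex a b s u :
  reindex_labels u (reindex_labels s a) = a ->
  reindex_labels u (reindex_labels s b) = b ->
  coupling R (reindex_labels s a) (reindex_labels s b) = coupling R a b.
Proof.
move=> sua sub; rewrite /coupling (type_size_reindex sua).
congr (if _ then _ else _); apply/idP/idP; last exact: same_type_reindex.
by move/(same_type_reindex u); rewrite sua sub.
Qed.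

End Coupling.

(* For [x = y z] one gets [x m x^T = (y m) z (y m)^T]. *)
Lemma psd_of_square (R : realType) (n : nat) (m z : 'M[R]_n) :
  m^T = m -> z^T = z -> m *m m = z *m m ->
  (forall v : 'rV_n, 0 <= (v *m z *m v^T) 0 0) ->
  (forall v : 'rV_n, (v *m z *m v^T) 0 0 = 0 -> v = 0) ->
  forall x : 'rV_n, 0 <= (x *m m *m x^T) 0 0.
Proof.
move=> mT zT mm zpos znd x.
have mz : m *m z = z *m m by rewrite -[LHS]trmxK trmx_mul mT zT -mm trmx_mul mT.
have zU : z \in unitmx.
  rewrite -row_free_unit; apply: inj_row_free => v vz; apply: znd.
  by rewrite vz mul0mx mxE.
rewrite -(mulmxKV zU x); move: (x *m invmx z) => v.
suff -> : v *m z *m m *m (v *m z)^T = (v *m m) *m z *m (v *m m)^T by apply: zpos.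
rewrite !trmx_mul mT zT !mulmxA; congr (_ *m _).
have e : z *m m *m z = m *m z *m m by rewrite -mm -mulmxA [in LHS]mz mulmxA.
by rewrite -(mulmxA v z m) -(mulmxA v _ z) e !mulmxA.
Qed.

Lemma kernel_psd (R : realType) (T : finType) (m z : T -> T -> R) :
  (forall u w, m u w = m w u) -> (forall u w, z u w = z w u) ->
  (forall u w, \sum_v m u v * m v w = \sum_v z u v * m v w) ->
  (forall x : T -> R, 0 <= \sum_u \sum_w x u * x w * z u w) ->
  (forall x : T -> R, \sum_u \sum_w x u * x w * z u w = 0 -> forall u, x u = 0) ->
  forall x : T -> R, 0 <= \sum_u \sum_w x u * x w * m u w.
Proof.
move=> ms zs mm zpos znd.
pose mx (k : T -> T -> R) : 'M_#|T| := \matrix_(i, j) k (enum_val i) (enum_val j).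
have mxT k : (forall u w, k u w = k w u) -> (mx k)^T = mx k.
  by move=> ks; apply/matrixP => i j; rewrite !mxE ks.
have mxM k l : mx k *m mx l = mx (fun u w => \sum_v k u v * l v w).
  apply/matrixP => i j; rewrite !mxE [RHS]big_enum_val /=.
  by apply: eq_bigr => v _; rewrite !mxE.
have quad (v : 'rV[R]_#|T|) k : (v *m mx k *m v^T) 0 0 =
    \sum_u \sum_w v 0 (enum_rank u) * v 0 (enum_rank w) * k u w.
  rewrite exchange_big /= mxE [RHS]big_enum_val; apply: eq_bigr => j _.
  rewrite !mxE big_distrl /= [RHS]big_enum_val; apply: eq_bigr => i _.
  by rewrite /= !enum_valK !mxE mulrAC.
move=> x; pose v : 'rV[R]_#|T| := \row_i x (enum_val i).
have := @psd_of_square R #|T| (mx m) (mx z) (mxT _ ms) (mxT _ zs) _ _ _ v.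
rewrite quad; under eq_bigr => u _ do
  under eq_bigr => w _ do rewrite !mxE !enum_rankK.
apply.
- by rewrite !mxM; apply/matrixP => i j; rewrite !mxE mm.
- by move=> v'; rewrite quad; apply: zpos.
move=> v'; rewrite quad => /(znd (fun u => v' 0 (enum_rank u))) v0.
by apply/rowP => i; rewrite mxE -(enum_valK i) v0.
Qed.

Lemma sum_pair (M : nmodType) (A B : finType) (F : A * B -> M) :
  \sum_u F u = \sum_a \sum_b F (a, b).
Proof. by rewrite pair_big; apply: eq_bigr => -[]. Qed.

(** * Positive semidefiniteness of the coupling *)

Section PairKernel.
Variables (R : realType) (t : nat) (G H : graph).
Hypothesis t_gt0 : (0 < t)%N.
Hypothesis formula_sums : forall phi : formula t,
  (\sum_(a : {ffun labels t -> G}) eval phi a =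
   \sum_(b : {ffun labels t -> H}) eval phi b)%N.

Local Notation TG := {ffun labels t -> G}.
Local Notation TH := {ffun labels t -> H}.
Local Notation PG := {ffun 'I_t -> G}.
Local Notation PH := {ffun 'I_t -> H}.

Let is_type (K K' : graph) (c : {ffun labels t -> K}) (a : {ffun labels t -> K'}) : R :=
  (same_type c a)%:R.

Definition swap_labels : {ffun labels t -> labels t} :=
  [ffun x => match x with inl i => inr i | inr i => inl i end].

Lemma reindex_swap (K : graph) (p q : {ffun 'I_t -> K}) :
  reindex_labels swap_labels (join p q) = join q p.
Proof. by apply/ffunP => -[i|i]; rewrite !ffunE. Qed.

Lemma sum_type_G (c a : TG) (X : TG -> R) (X' : TH -> R) : definable X X' ->
  same_type c a -> \sum_d is_type c d * X d = (type_size G c)%:R * X a.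
Proof.
move=> dX ca; rewrite -(type_sizeE R c G) big_distrl; apply: eq_bigr => d _ /=.
rewrite /is_type; have [cd|] := boolP (same_type c d); rewrite ?mul0r // !mul1r.
by apply: (definable_same_type_GG dX); rewrite -(same_type_trans _ cd).
Qed.

Lemma sum_type_H (c b : TH) (X : TG -> R) (X' : TH -> R) : definable X X' ->
  same_type c b -> \sum_d is_type c d * X' d = (type_size H c)%:R * X' b.
Proof.
move=> dX cb; rewrite -(type_sizeE R c H) big_distrl; apply: eq_bigr => d _ /=.
rewrite /is_type; have [cd|] := boolP (same_type c d); rewrite ?mul0r // !mul1r.
by apply: (definable_same_type_HH dX); rewrite -(same_type_trans _ cd).
Qed.

Lemma couplingE_G (a : TG) (b : TH) :
  coupling R a b = is_type a b / (type_size G a)%:R.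
Proof.
by rewrite /coupling /is_type; case: same_type; rewrite ?mul1r ?mul0r.
Qed.

Lemma couplingE_H (a : TG) (b : TH) :
  coupling R a b = is_type b a / (type_size H b)%:R.
Proof. by rewrite (coupling_swap R t_gt0 formula_sums) /coupling /is_type;
  case: same_type; rewrite ?mul1r ?mul0r. Qed.

Lemma size_neq0 (K : graph) (c : {ffun labels t -> K}) : (type_size K c)%:R != 0 :> R.
Proof. by rewrite pnatr_eq0 -lt0n type_size_gt0. Qed.

(** The sum runs over tuples rather than types, so a type with [n] tuples is counted [n] times;
    hence the weight [n ^- 2] in place of [n^-1]. *)
Lemma couplingE_sum (a : TG) (b : TH) : coupling R a b =
  \sum_(c : TG) (type_size G c)%:R ^- 2 * (is_type c a * is_type c b).
Proof.
rewrite couplingE_G.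
transitivity (\sum_(c : TG) is_type a c * ((type_size G a)%:R ^- 2 * is_type a b)).
  rewrite -big_distrl /= (type_sizeE R a G) mulrA mulrC; congr (_ * _).
  by rewrite expr2 invfM mulrA divff ?mul1r // size_neq0.
apply: eq_bigr => c _; rewrite /is_type [same_type c a]same_type_sym.
have [ac|nac] := boolP (same_type a c); rewrite ?mul0r ?mulr0 //.
by rewrite !mul1r -(same_type_trans b ac) (type_size_eq G ac).
Qed.

(** Double counting. Cleared of denominators, the left side sums [X (join u w)] over the triples
    [u, w, r] in [G] with [join u r] of the type of [al] and [join w r] of the type of [be]. This is
    the sum of a definable function, so it equals its counterpart in [H], which is the right
    side. *)
Lemma coupling_intertwines (X : TG -> R) (X' : TH -> R) p q p' q' : definable X X' ->
  \sum_s X (join p s) * coupling R (join s q) (join p' q') =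
  \sum_s X' (join s p') * coupling R (join p q) (join s q').
Proof.
move=> dX; set al := join p q; set be := join p' q'.
have dZ := definable_comp dX (definable_type R G H t_gt0 be).
have dY := definable_comp (definable_reindex swap_labels dX)
  (definable_type R G H t_gt0 al).
set Z := (fun a => \sum_w X (join (lpart a) w) * _) in dZ.
set Y' := (fun b : TH => _) in dY; set Y := (fun a : TG => _) in dY.
transitivity (Z al / (type_size H be)%:R).
  rewrite big_distrl; apply: eq_bigr => s _ /=.
  by rewrite couplingE_H mulrA lpart_join rpart_join.
transitivity (Y' be / (type_size G al)%:R); last first.
  rewrite big_distrl; apply: eq_bigr => s _ /=.
  by rewrite couplingE_G mulrA lpart_join rpart_join reindex_swap.
suff h : (type_size G al)%:R * Z al = (type_size H be)%:R * Y' be.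
  by apply/eqP; rewrite eqr_div ?size_neq0 // mulrC h mulrC.
rewrite -(sum_type_G dZ (same_type_refl al)) -(sum_type_H dY (same_type_refl be)).
transitivity (\sum_a is_type be a * Y a).
  rewrite sum_join [RHS]sum_join /=.
  rewrite exchange_big [RHS]exchange_big /=; apply: eq_bigr => r _.
  transitivity (\sum_u \sum_w is_type al (join u r) * (X (join u w) * is_type be (join w r))).
    by apply: eq_bigr => u _; rewrite /Z lpart_join rpart_join big_distrr.
  rewrite exchange_big /=; apply: eq_bigr => w _.
  rewrite /Y lpart_join rpart_join big_distrr; apply: eq_bigr => u _ /=.
  by rewrite reindex_swap /is_type; ring.
exact: (definable_sum formula_sums (definable_mul (definable_type R G H t_gt0 be) dY)).
Qed.

Let m (u w : PG * PH) : R := coupling R (join u.1 w.1) (join u.2 w.2).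

(** With [A_c] the 0-1 matrix on [PH] of the type of [c], this is the weighted sum of the products
    of [A_c] with its transpose. *)
Let zz (p r : PH) : R := \sum_(c : TG) (type_size G c)%:R ^- 2 *
  \sum_s is_type c (join p s) * is_type c (join r s).

Let z (u w : PG * PH) : R := (u.1 == w.1)%:R * zz u.2 w.2.

Let z_quad (x : PG * PH -> R) : \sum_u \sum_w x u * x w * z u w =
  \sum_(p : PG) \sum_(c : TG) \sum_(s : PH) (type_size G c)%:R ^- 2 *
    (\sum_(r : PH) x (p, r) * is_type c (join r s)) ^+ 2.
Proof.
rewrite sum_pair.
apply: eq_bigr => p _.
transitivity (\sum_r \sum_r2 x (p, r) * x (p, r2) * zz r r2).
  apply: eq_bigr => r _.
  rewrite sum_pair.
  rewrite (bigD1 p) //= [X in _ + X]big1 ?addr0.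
    by apply: eq_bigr => r2 _; rewrite /z eqxx mul1r.
  move=> p2 np; apply: big1 => r2 _.
  by rewrite /z /= eq_sym (negbTE np) mul0r mulr0.
transitivity (\sum_r \sum_r2 \sum_(c : TG) \sum_s (type_size G c)%:R ^- 2 *
    ((x (p, r) * is_type c (join r s)) * (x (p, r2) * is_type c (join r2 s)))).
  apply: eq_bigr => r _; apply: eq_bigr => r2 _; rewrite /zz big_distrr.
  apply: eq_bigr => c _; rewrite big_distrr big_distrr; apply: eq_bigr => s _ /=.
  by ring.
under eq_bigr => r _ do rewrite exchange_big /=.
rewrite exchange_big /=; apply: eq_bigr => c _.
under eq_bigr => r _ do rewrite exchange_big /=.
rewrite exchange_big /=; apply: eq_bigr => s _.
rewrite [X in _ = _ * X]expr2 big_distrlr big_distrr; apply: eq_bigr => r _ /=.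
by rewrite big_distrr.
Qed.

(** By [couplingE_sum], [m] is the weighted sum of the tensor products of the type matrices of [G]
    and [H]. In [m] times [m], [coupling_intertwines] moves the factor on [G] to a transposed factor
    on [H], which leaves [z] times [m]. *)
Lemma coupling_psd (x : PG * PH -> R) : 0 <= \sum_u \sum_w x u * x w * m u w.
Proof.
have w_ge0 (c : TG) : 0 <= (type_size G c)%:R ^- 2 :> R.
  by rewrite invr_ge0 exprn_ge0.
apply: (kernel_psd (z := z)) x.
- move=> u w; rewrite /m -[RHS](@coupling_reindex R t G H _ _ swap_labels swap_labels).
  + by rewrite !reindex_swap.
  + by rewrite !reindex_swap.
  by rewrite !reindex_swap.
- move=> u w; rewrite /z eq_sym; congr (_ * _); apply: eq_bigr => c _.
  by congr (_ * _); apply: eq_bigr => s _; rewrite mulrC.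
- move=> [p p'] [q q'].
  rewrite [LHS]sum_pair [RHS]sum_pair.
  rewrite [RHS](bigD1 p) //= [X in _ = _ + X]big1 ?addr0; last first.
    move=> p2 np; apply: big1 => r2 _.
    by rewrite /z /= eq_sym (negbTE np) !mul0r.
  transitivity (\sum_(c : TG) (type_size G c)%:R ^- 2 * \sum_s' is_type c (join p' s') *
      \sum_s is_type c (join p s) * m (s, s') (q, q')).
    rewrite exchange_big /=.
    under [RHS]eq_bigr => c _ do rewrite big_distrr /=.
    rewrite [RHS]exchange_big /=; apply: eq_bigr => s' _.
    under [RHS]eq_bigr => c _ do rewrite mulrA big_distrr /=.
    rewrite [RHS]exchange_big /=; apply: eq_bigr => s _.
    rewrite {1}/m /= couplingE_sum big_distrl; apply: eq_bigr => c _ /=.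
    by ring.
  transitivity (\sum_(c : TG) (type_size G c)%:R ^- 2 * \sum_s' is_type c (join p' s') *
      \sum_r is_type c (join r s') * m (p, r) (q, q')).
    apply: eq_bigr => c _; congr (_ * _); apply: eq_bigr => s' _; congr (_ * _).
    exact: (coupling_intertwines p q s' q' (definable_type R G H t_gt0 c)).
  transitivity (\sum_r zz p' r * m (p, r) (q, q')); last first.
    by apply: eq_bigr => r _; rewrite /z eqxx mul1r.
  rewrite /zz; under [RHS]eq_bigr => r _ do rewrite big_distrl /=.
  rewrite [RHS]exchange_big /=; apply: eq_bigr => c _.
  under eq_bigr => s' _ do rewrite big_distrr /=.
  rewrite exchange_big big_distrr /=; apply: eq_bigr => r _.
  rewrite -mulrA; congr (_ * _); rewrite big_distrl /=.
  by apply: eq_bigr => s' _; rewrite mulrA.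
- move=> x; rewrite z_quad; do 3!(apply: sumr_ge0 => ? _).
  by rewrite mulr_ge0 ?sqr_ge0.
move=> x; rewrite z_quad => x0 [p r0].
(* Definiteness: the type of the diagonal tuple [join r0 r0] forces left and right labels to be
   equal, so in the square for this [c] and [s = r0] only the term of [x (p, r0)] survives. *)
have [c cP] : exists c : TG, same_type (join r0 r0) c.
  have : (0 < type_size G (join r0 r0))%N.
    by rewrite (type_size_GH R t_gt0 formula_sums) type_size_gt0.
  by case/card_gt0P => c; rewrite inE => h; exists c.
have nn (p1 : PG) (c1 : TG) (s : PH) : 0 <= (type_size G c1)%:R ^- 2 *
    (\sum_r x (p1, r) * is_type c1 (join r s)) ^+ 2 :> R.
  by rewrite mulr_ge0 ?sqr_ge0.
have : (type_size G c)%:R ^- 2 *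
    (\sum_r x (p, r) * is_type c (join r r0)) ^+ 2 = 0 :> R.
  have /(_ p isT)/psumr_eq0P : forall p1, true -> \sum_(c1 : TG) \sum_(s : PH)
      (type_size G c1)%:R ^- 2 * (\sum_r x (p1, r) * is_type c1 (join r s)) ^+ 2 = 0 :> R.
    apply: psumr_eq0P x0 => p1 _; do 2!(apply: sumr_ge0 => ? _); exact: nn.
  move/(_ _ c isT)/psumr_eq0P; apply=> //.
  by move=> c1 _; apply: sumr_ge0 => ? _; apply: nn.
move/eqP; rewrite mulf_eq0 invr_eq0 expf_eq0 /= (negbTE (size_neq0 c)) /= sqrf_eq0.
rewrite (bigD1 r0) //= big1 ?addr0.
  by rewrite /is_type same_type_sym cP mulr1 => /eqP.
move=> r nr; rewrite /is_type; case: (boolP (same_type _ _)) => [cr|]; last first.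
  by rewrite mulr0.
case/eqP: nr; apply/ffunP => k; apply/eqP.
have := same_type_eq (inl k) (inr k) cr.
by rewrite -(same_type_eq (inl k) (inr k) cP) !ffunE eqxx => /esym.
Qed.

End PairKernel.

Lemma enumerate_set (A T : finType) (I : {set T}) : I != set0 -> (#|I| <= #|A|)%N ->
  exists s : {ffun A -> T}, [set s i | i : A] = I.
Proof.
case/set0Pn=> x0 x0I hI.
exists [ffun i => nth x0 (enum I) (enum_rank i)].
apply/setP => x; apply/imsetP/idP => [[i _ ->]|xI].
  rewrite ffunE; have [lt|ge] := ltnP (enum_rank i) (size (enum I)).
    by rewrite -mem_enum mem_nth.
  by rewrite nth_default.
have lt : (index x (enum I) < #|I|)%N by rewrite cardE index_mem mem_enum.
exists (enum_val (Ordinal (leq_trans lt hI))) => //.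
by rewrite ffunE enum_valK nth_index ?mem_enum.
Qed.

(** * The solution of the system *)

Section Solution.
Variables (R : realType) (t : nat) (G H : graph).
Hypothesis t_gt0 : (0 < t)%N.
Hypothesis formula_sums : forall phi : formula t,
  (\sum_(a : {ffun labels t -> G}) eval phi a =
   \sum_(b : {ffun labels t -> H}) eval phi b)%N.

Local Notation L := (labels t).
Implicit Types (s : {ffun L -> G * H}) (I J : {set G * H}).

Let label0 : L := inl (Ordinal t_gt0).

Definition first s : {ffun L -> G} := [ffun i => (s i).1].
Definition second s : {ffun L -> H} := [ffun i => (s i).2].
Definition tuple_set s : {set G * H} := [set s i | i : L].
Definition pair_coupling s : R := coupling R (first s) (second s).

(** The default 1 is the value required at the empty set, which no tuple enumerates as [t] is
    positive. *)
Definition solution I : R :=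
  if [pick s | tuple_set s == I] is Some s then pair_coupling s else 1.

(** Two tuples with the same set of entries are renamings of each other, so [coupling_reindex] makes
    the choice irrelevant. *)
Lemma solutionE s : solution (tuple_set s) = pair_coupling s.
Proof.
rewrite /solution; case: pickP => [s' /eqP ss'|/(_ s)]; last by rewrite eqxx.
have sub s1 s2 : tuple_set s1 = tuple_set s2 ->
    exists u : {ffun L -> L}, forall i, s2 (u i) = s1 i.
  move=> e; have [u hu] : exists u : L -> L, forall i, s2 (u i) = s1 i.
    apply: (@fin_all_exists _ (fun=> L) (fun i j => s2 j = s1 i)) => i.
    have : s1 i \in tuple_set s2 by rewrite -e; apply: imset_f.
    by case/imsetP=> j _ ->; exists j.
  by exists [ffun i => u i] => i; rewrite ffunE hu.
have [u hu] := sub _ _ ss'; have [v hv] := sub _ _ (esym ss').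
rewrite /pair_coupling -(@coupling_reindex R t G H (first s) (second s) u v).
- by congr (coupling R _ _); apply/ffunP => i; rewrite !ffunE hu.
- by apply/ffunP => i; rewrite !ffunE hu hv.
by apply/ffunP => i; rewrite !ffunE hu hv.
Qed.

Lemma solution_empty : solution set0 = 1.
Proof.
rewrite /solution; case: pickP => // s /eqP/setP/(_ (s label0)).
by rewrite inE imset_f.
Qed.

Lemma card_labels : #|L| = (2 * t)%N.
Proof. by rewrite card_sum card_ord addnn mul2n. Qed.

Lemma solution_tuple I : I != set0 -> (#|I| <= 2 * t)%N -> exists s, tuple_set s = I.
Proof. by move=> I0 hI; apply: enumerate_set; rewrite ?card_labels. Qed.

Lemma solution_ge0 I : 0 <= solution I.
Proof.
by rewrite /solution; case: pickP => [s _|//]; apply: coupling_ge0.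
Qed.

Lemma solution_partial_iso I : (#|I| <= 2 * t)%N -> ~~ partial_iso I -> solution I = 0.
Proof.
move=> hI nI; have [I0|I0] := eqVneq I set0.
  by case/negP: nI; apply/forall_inP => p; rewrite I0 inE.
have [s es] := solution_tuple I0 hI; rewrite -es solutionE /pair_coupling /coupling.
case: ifP => // st; case/negP: nI; rewrite -es.
apply/forall_inP => _ /imsetP[i _ ->]; apply/forall_inP => _ /imsetP[j _ ->].
have := same_type_eq i j st; have := same_type_edge i j st.
by rewrite !ffunE => -> ->; rewrite !eqxx.
Qed.

Lemma collision I s : tuple_set s = I -> (#|I| <= 2 * t - 1)%N ->
  exists i j, j != i /\ s i = s j.
Proof.
move=> es hI; have /injectivePn[i [j ij sij]] : ~~ injectiveb s.
  apply/negP => /injectiveP sinj.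
  have := card_imset predT sinj; rewrite -/(tuple_set s) es => e.
  by move: hI; rewrite e card_labels; lia.
by exists i, j; rewrite eq_sym.
Qed.

Lemma tuple_set_update s i j x : j != i -> s i = s j ->
  tuple_set (update s i x) = tuple_set s :|: [set x].
Proof.
move=> ji sij; apply/setP => z; rewrite !inE; apply/imsetP/orP.
  case=> k _ ->; rewrite ffunE; case: eqP => _; first by right.
  by left; apply: imset_f.
case=> [/imsetP[k _ ->]|/eqP->]; last by exists i; rewrite // ffunE eqxx.
have [->|ki] := eqVneq k i; first by exists j; rewrite // ffunE (negbTE ji).
by exists k; rewrite // ffunE (negbTE ki).
Qed.

Lemma tuple_set_const x : tuple_set [ffun=> x] = [set x].
Proof.
apply/setP => z; rewrite inE; apply/imsetP/eqP => [[i _ ->]|->].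
  by rewrite ffunE.
by exists label0; rewrite // ffunE.
Qed.

(** A tuple of length [2t] enumerating a nonempty [I] repeats an entry. One of the repeated
    positions is free to hold [(g, h)], and [coupling_marginal] sums it out. *)
Lemma solution_sumH I (g : G) : (#|I| <= 2 * t - 1)%N ->
  \sum_h solution (I :|: [set (g, h)]) = solution I.
Proof.
move=> hI; have [->|I0] := eqVneq I set0.
  rewrite solution_empty -(coupling_mass R t_gt0 formula_sums [ffun=> g]).
  rewrite [RHS](bigID (fun b : {ffun L -> H} => b == [ffun=> b label0])) /=.
  (* Only constant tuples have the type of a constant tuple, so the whole mass sits on the
     singletons [(g, h)]. *)
  rewrite [X in _ = _ + X]big1 ?addr0; last first.
    move=> b nb; rewrite /coupling; case: ifP => // st; case/eqP: nb.
    apply/ffunP => i; rewrite ffunE; apply/eqP.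
    by rewrite -(same_type_eq i label0 st) !ffunE.
  rewrite (reindex_onto (fun h => [ffun=> h]) (fun b : {ffun L -> H} => b label0)) /=.
    apply: eq_big => [h|h _]; first by rewrite !ffunE !eqxx.
    rewrite set0U -tuple_set_const solutionE /pair_coupling.
    by congr (coupling R _ _); apply/ffunP => i; rewrite !ffunE.
  by move=> b /eqP <-.
have [|s es] := solution_tuple I0; first by apply: leq_trans hI _; lia.
have [i [j [ji sij]]] := collision es hI.
rewrite -[in RHS]es solutionE /pair_coupling.
have ai : update (update (first s) i g) i (update (first s) i g j) = first s.
  apply/ffunP => k; rewrite !ffunE (negbTE ji).
  by have [->|] := eqVneq k i; rewrite ?sij.
have bi : update (second s) i (second s j) = second s.
  by apply/ffunP => k; rewrite !ffunE; have [->|] := eqVneq k i; rewrite ?sij.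
rewrite -[in RHS]ai -[in RHS]bi -(coupling_marginal R t_gt0) //.
apply: eq_bigr => h _; rewrite -es -(tuple_set_update _ ji sij) solutionE.
by congr (coupling R _ _); apply/ffunP => k; rewrite !ffunE; case: eqP.
Qed.

Let pair_set (u : {ffun 'I_t -> G} * {ffun 'I_t -> H}) : {set G * H} :=
  [set (u.1 k, u.2 k) | k : 'I_t].

Let pair_set_card u : (#|pair_set u| <= t)%N.
Proof. by apply: leq_trans (leq_imset_card _ _) _; rewrite card_ord. Qed.

Let solution_pair u w : solution (pair_set u :|: pair_set w) =
  coupling R (join u.1 w.1) (join u.2 w.2).
Proof.
pose s : {ffun L -> G * H} := [ffun x => (join u.1 w.1 x, join u.2 w.2 x)].
have -> : pair_set u :|: pair_set w = tuple_set s.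
  apply/setP => p; rewrite inE; apply/orP/imsetP.
    by case=> /imsetP[k _ ->]; [exists (inl k)|exists (inr k)]; rewrite // !ffunE.
  case=> -[k|k] _ ->; rewrite !ffunE; [left|right]; apply/imsetP; by exists k.
rewrite solutionE /pair_coupling.
by congr (coupling R _ _); apply/ffunP => k; rewrite ![RHS]ffunE !ffunE.
Qed.

(* The row of the moment matrix indexed by the empty set is the sum over [h]
   of the rows indexed by [{(g0, h)}]. *)
Let row_combination (g0 : G) I :
  exists c : {ffun 'I_t -> G} * {ffun 'I_t -> H} -> R, (#|I| <= t)%N ->
  forall J, (#|J| <= t)%N ->
  \sum_u c u * solution (pair_set u :|: J) = solution (I :|: J).
Proof.
have delta v (f : {ffun 'I_t -> G} * {ffun 'I_t -> H} -> R) :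
    \sum_u (u == v)%:R * f u = f v.
  rewrite (bigD1 v) //= eqxx mul1r big1 ?addr0 // => u /negbTE->.
  by rewrite mul0r.
have [->|I0] := eqVneq I set0.
  exists (fun u => \sum_h (u == ([ffun=> g0], [ffun=> h]))%:R) => _ J hJ.
  under eq_bigr => u _ do rewrite big_distrl /=.
  rewrite exchange_big /= set0U -[RHS](@solution_sumH _ g0); last first.
    by apply: leq_trans hJ _; lia.
  apply: eq_bigr => h _; rewrite delta setUC; congr (solution (_ :|: _)).
  apply/setP => z; rewrite inE; apply/imsetP/eqP => [[k _ ->]|->].
    by rewrite !ffunE.
  by exists (Ordinal t_gt0); rewrite // !ffunE.
have [hI|nI] := boolP (#|I| <= t)%N; last by exists (fun=> 0).
have [|s es] := @enumerate_set 'I_t _ I I0; first by rewrite card_ord.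
exists (fun u => (u == ([ffun k => (s k).1], [ffun k => (s k).2]))%:R) => _ J hJ.
rewrite delta; congr (solution (_ :|: _)); rewrite -es.
by apply: eq_imset => k; rewrite !ffunE; case: (s k).
Qed.

Let moment_quadratic (x : 'cV[R]_#|subsets_upto ((G * H)%type : finType) t|) :
  (x^T *m moment_matrix t solution *m x) 0 0 =
  \sum_i \sum_j x i 0 * x j 0 * solution (enum_val i :|: enum_val j).
Proof.
rewrite mxE exchange_big; apply: eq_bigr => j _ /=; rewrite !mxE big_distrl /=.
by apply: eq_bigr => i _; rewrite !mxE mulrAC.
Qed.

Lemma solution_psd : psd (moment_matrix t solution).
Proof.
split=> [|x]; first by apply/matrixP => i j; rewrite !mxE setUC.
rewrite moment_quadratic.
have val_card (i : 'I_#|subsets_upto ((G * H)%type : finType) t|) : (#|enum_val i| <= t)%N.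
  by have := enum_valP i; rewrite inE.
(* If [G] is empty, the empty set is the only index and the form is a square. *)
have [g0 _|G0] := pickP (predT : pred G); last first.
  have set_empty I : I = set0.
    by apply/setP => -[g h]; have := G0 g.
  under eq_bigr => i _ do under eq_bigr => j _ do
    rewrite (set_empty (_ :|: _)) solution_empty mulr1.
  rewrite [X in 0 <= X](_ : _ = (\sum_i x i 0) ^+ 2) ?sqr_ge0 //.
  by rewrite expr2 big_distrlr.
have [c cP] : exists c : 'I_#|subsets_upto ((G * H)%type : finType) t| ->
    ({ffun 'I_t -> G} * {ffun 'I_t -> H} -> R), forall i J, (#|J| <= t)%N ->
    \sum_u c i u * solution (pair_set u :|: J) = solution (enum_val i :|: J).
  apply: (@fin_all_exists _ (fun=> {ffun 'I_t -> G} * {ffun 'I_t -> H} -> R)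
    (fun i c => forall J, (#|J| <= t)%N ->
    \sum_u c u * solution (pair_set u :|: J) = solution (enum_val i :|: J))) => i.
  by have [c hc] := row_combination g0 (enum_val i); exists c; apply: hc.
(* Every row is a combination of rows indexed by pairs of [t]-tuples, so the form at [x] is the form
   of [coupling_psd] at [X]. *)
pose X u := \sum_i x i 0 * c i u.
have := coupling_psd t_gt0 formula_sums X; congr (0 <= _).
transitivity (\sum_u \sum_w \sum_i \sum_j x i 0 * x j 0 *
    (c i u * (c j w * solution (pair_set w :|: pair_set u)))).
  apply: eq_bigr => u _; apply: eq_bigr => w _.
  rewrite /X big_distrlr big_distrl; apply: eq_bigr => i _ /=.
  rewrite big_distrl; apply: eq_bigr => j _ /=.
  by rewrite setUC solution_pair; ring.
under eq_bigr => u _ do rewrite exchange_big /=.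
rewrite exchange_big /=; apply: eq_bigr => i _.
under eq_bigr => u _ do rewrite exchange_big /=.
rewrite exchange_big /=; apply: eq_bigr => j _.
rewrite -(cP i) // big_distrr; apply: eq_bigr => u _ /=.
rewrite setUC -(cP j) ?pair_set_card // !big_distrr; apply: eq_bigr => w _ /=.
by [].
Qed.

End Solution.

Section SolutionSwap.
Variables (R : realType) (t : nat) (G H : graph).
Hypothesis t_gt0 : (0 < t)%N.
Hypothesis formula_sums : forall phi : formula t,
  (\sum_(a : {ffun labels t -> G}) eval phi a =
   \sum_(b : {ffun labels t -> H}) eval phi b)%N.

Let flip (K K' : graph) (p : K * K') : K' * K := (p.2, p.1).

Let flip_inj (K K' : graph) : injective (@flip K K').
Proof. by move=> [a b] [c d] [-> ->]. Qed.

Let tuple_set_flip (K K' : graph) (s : {ffun labels t -> K * K'}) :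
  tuple_set [ffun i => flip (s i)] = @flip K K' @: tuple_set s.
Proof.
by rewrite /tuple_set -imset_comp; apply: eq_imset => i; rewrite ffunE.
Qed.

(** The coupling is symmetric since types are equally frequent in both graphs; this reduces the sums
    over [G] to [solution_sumH] with the graphs exchanged. *)
Lemma solution_swap (I : {set G * H}) :
  solution R t I = solution R t (@flip G H @: I).
Proof.
have [s /eqP es|none] := pickP (fun s : {ffun labels t -> G * H} => tuple_set s == I).
  rewrite -es -tuple_set_flip !solutionE /pair_coupling.
  rewrite (coupling_swap R t_gt0 formula_sums).
  by congr (coupling R _ _); apply/ffunP => i; rewrite !ffunE.
rewrite {1}/solution; case: pickP => [s|_]; first by rewrite none.
rewrite /solution; case: pickP => // s /eqP es.
have := none [ffun i => flip (s i)]; rewrite tuple_set_flip es -imset_comp.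
by rewrite (eq_imset (g := id)) ?imset_id ?eqxx // => -[].
Qed.

Lemma solution_sumG (I : {set G * H}) (h : H) : (#|I| <= 2 * t - 1)%N ->
  \sum_g solution R t (I :|: [set (g, h)]) = solution R t I.
Proof.
move=> hI; rewrite solution_swap.
rewrite -(@solution_sumH R t H G t_gt0 (fun phi => esym (formula_sums phi)) _ h).
  by apply: eq_bigr => g _; rewrite solution_swap imsetU imset_set1.
by rewrite (card_imset _ (@flip_inj G H)).
Qed.

End SolutionSwap.

Lemma hom_lasserre (R : realType) (t : nat) (G H : graph) : (0 < t)%N ->
  simple G -> simple H -> hom_indistinguishable (lasserre_class t) G H ->
  lasserre_plus R t G H.
Proof.
move=> t0 sG sH hGH; have fs := formula_sum (t := t) (G := G) (H := H).
have {}fs phi := fs phi sG sH hGH.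
have le_pred n : (n <= 2 * t - 2)%N -> (n <= 2 * t - 1)%N by lia.
exists (@solution R t G H); split.
- exact: solution_psd.
- by move=> I g /le_pred; apply: solution_sumH.
- by move=> I h /le_pred; apply: solution_sumG.
- by move=> I; apply: solution_partial_iso.
by split=> [|I _]; [exact: solution_empty|exact: solution_ge0].
Qed.

Local Close Scope ring_scope.

Theorem theorem1p3 (R : realType) (t : nat) (t_ge1 : 1 <= t) :
  exists L : graph -> Prop,
    [/\ minor_closed L,
        forall F : graph, L F -> treewidth_at_most F (3 * t - 1)
      & forall G H : graph, simple G -> simple H ->
          (lasserre_plus R t G H <-> hom_indistinguishable L G H)].
Proof.
exists (lasserre_class t); split.
- exact: lasserre_class_minor_closed.
- by move=> F; apply: lasserre_class_treewidth.
move=> G H sG sH; split; first exact: lasserre_hom.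
exact: hom_lasserre.
Qed.
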